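(* Let $n\ge 3$ and $T_n=\{(a,b,c)\in\mathbb N^3 : 1\le a<b<c\le n\}$. For every $G\in B_n^+$, the following chain of identities holds (all twelve sums below are equal to each other): $$\sum_{(a,b,c)\in T_n} l\bigl(Y_{abc}(\check G)\bigr)=\sum_{(a,b,c)\in T_n} l\Bigl(\frac{1}{Y_{abc}(G)}\Bigr)=\sum_{(a,b,c)\in T_n} l\bigl(Y_{abc}(\hat G)\bigr)$$ $$=\sum_{(a,b,c)\in T_n} l\bigl(\tilde Y^{abc}(\check G)\bigr)=\sum_{(a,b,c)\in T_n} l\Bigl(\frac{1}{\tilde Y^{abc}(G)}\Bigr)=\sum_{(a,b,c)\in T_n} l\bigl(\tilde Y^{abc}(\hat G)\bigr)$$ $$=\sum_{(a,b,c)\in T_n} l\bigl(\tilde Y_{abc}(\check G)\bigr)=\sum_{(a,b,c)\in T_n} l\Bigl(\frac{1}{\tilde Y_{abc}(G)}\Bigr)=\sum_{(a,b,c)\in T_n} l\bigl(\tilde Y_{abc}(\hat G)\bigr)$$ $$=\sum_{(a,b,c)\in T_n} l\bigl(Y^{abc}(\check G)\bigr)=\sum_{(a,b,c)\in T_n} l\Bigl(\frac{1}{Y^{abc}(G)}\Bigr)=\sum_{(a,b,c)\in T_n} l\bigl(Y^{abc}(\hat G)\bigr).$$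
   Context: Dilogarithm: for $x\in(0,1)$ the Rogers dilogarithm is $L(x)=\mathrm{Li}_2(x)+\frac12\log x\,\log(1-x)$, and for $x>0$ one sets $l(x)=\frac{6}{\pi^2}L\bigl(\frac{x}{1+x}\bigr)$. Matrices: $B_n$ is the group of $n\times n$ real invertible upper triangular matrices. $G\in B_n$ is totally positive if every minor of $G$ that does not vanish identically (as a function on $B_n$) is positive. $B_n^+\subset B_n$ is the subset of totally positive matrices. Flag minors: $[a,b]=\{i\in\mathbb N: a\le i\le b\}$ (empty if $a>b$). For $I,J\subset[1,n]$, $\Delta_I$ is the minor on the rows labeled by $I$ and the last $|I|$ columns; $\Delta^J$ is the minor on the first $|J|$ rows and the columns labeled by $J$; $\Delta_\emptyset=\Delta^\emptyset=1$. Maps $G\mapsto\check G$, $G\mapsto\hat G$: for $I\subset[1,n]$ let $\bar I=\{a\in[1,n]: n+1-a\in I\}$. For every $G\in B_n^+$ there exist unique $\check G,\hat G\in B_n^+$ such that $\Delta_I(\check G)=\Delta_{\bar I}(G)$ and $\Delta^J(\hat G)=\Delta^{\bar J}(G)$ for all $I,J\subset[1,n]$. Y-variables of a matrix $G\in B_n^+$, for $1\le a<b<c\le n$ (all minors are those of $G$): $$Y_{abc}(G)=\frac{\Delta_{[a,b-1]\cup[c+1,n]}\,\Delta_{[a+1,b]\cup[c,n]}}{\Delta_{[a,b]\cup[c+1,n]}\,\Delta_{[a+1,b-1]\cup[c,n]}},\qquad \tilde Y_{abc}(G)=\frac{\Delta_{[1,a]\cup[b+1,c-1]}\,\Delta_{[1,a-1]\cup[b,c]}}{\Delta_{[1,a]\cup[b,c-1]}\,\Delta_{[1,a-1]\cup[b+1,c]}},$$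 $$Y^{abc}(G)=\frac{\Delta^{[a,b]\cup[c+1,n]}\,\Delta^{[a+1,b-1]\cup[c,n]}}{\Delta^{[a,b-1]\cup[c+1,n]}\,\Delta^{[a+1,b]\cup[c,n]}},\qquad \tilde Y^{abc}(G)=\frac{\Delta^{[1,a]\cup[b,c-1]}\,\Delta^{[1,a-1]\cup[b+1,c]}}{\Delta^{[1,a]\cup[b+1,c-1]}\,\Delta^{[1,a-1]\cup[b,c]}}.$$ *)

(* Defs.v *)
From HB Require Import structures.
From mathcomp Require Import all_boot all_order all_algebra.
From mathcomp Require Import all_classical all_reals all_analysis.

Set Implicit Arguments.
Unset Strict Implicit.
Unset Printing Implicit Defensive.

Import Order.TTheory GRing.Theory Num.Theory.
Import numFieldNormedType.Exports.

Local Open Scope ring_scope.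

(* Li_2(x) = sum_(k >= 1) x^k / k^2 for 0 <= x < 1; the k = 0 term of the
   power series vanishes because 0^-1 = 0. *)
Definition dilog (R : realType) (x : R) : R :=
  limn (pseries (fun k => (k%:R ^+ 2)^-1) x).

Definition rogers_dilog (R : realType) (x : R) : R :=
  dilog x + 2^-1 * (ln x * ln (1 - x)).

Definition ldilog (R : realType) (x : R) : R :=
  6 / pi ^+ 2 * rogers_dilog (x / (1 + x)).

Section IndexSets.
Variable n : nat.

(* Integer bounds a, b are 1-based, as in the mathematical notation, whereas
   the value of i : 'I_n is 0-based: i stands for the label i.+1. *)
Definition itv_set (a b : nat) : {set 'I_n} := [set i : 'I_n | a <= i.+1 <= b]%N.

(* On labels, rev_ord is a |-> n + 1 - a. *)
Definition bar_set (I : {set 'I_n}) : {set 'I_n} :=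
  [set a : 'I_n | rev_ord a \in I].

Definition first_set (k : nat) : {set 'I_n} := itv_set 1 k.
Definition last_set (k : nat) : {set 'I_n} := itv_set (n - k).+1 n.

End IndexSets.

Section Minors.
Variables (R : realType) (n : nat).
Implicit Types (G H : 'M[R]_n) (I J : {set 'I_n}).

(* Only meaningful when #|I| = #|J|: column j of the submatrix is then the
   j-th smallest element of J, and the default value of nth is never used. *)
Definition minor I J G : R :=
  \det (\matrix_(i < #|I|, j < #|I|) G (enum_val i) (nth (enum_val i) (enum J) j)).

Definition in_B G : Prop := is_trig_mx G^T /\ G \in unitmx.

Definition in_Bplus G : Prop :=
  in_B G /\
  forall I J, #|I| = #|J| -> (exists2 H, in_B H & minor I J H != 0) ->
    0 < minor I J G.

Definition Delta_lo I G : R := minor I (last_set n #|I|) G.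
Definition Delta_up J G : R := minor (first_set n #|J|) J G.

Definition is_check G H : Prop :=
  in_Bplus H /\ forall I, Delta_lo I H = Delta_lo (bar_set I) G.

Definition is_hat G H : Prop :=
  in_Bplus H /\ forall J, Delta_up J H = Delta_up (bar_set J) G.

Local Notation "[[ a , b ]]" := (itv_set n a b) (at level 0).

Definition Y_lo G (a b c : nat) : R :=
  (Delta_lo ([[a, b - 1]] :|: [[c + 1, n]]) G
   * Delta_lo ([[a + 1, b]] :|: [[c, n]]) G)
  / (Delta_lo ([[a, b]] :|: [[c + 1, n]]) G
     * Delta_lo ([[a + 1, b - 1]] :|: [[c, n]]) G).

Definition Yt_lo G (a b c : nat) : R :=
  (Delta_lo ([[1, a]] :|: [[b + 1, c - 1]]) G
   * Delta_lo ([[1, a - 1]] :|: [[b, c]]) G)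
  / (Delta_lo ([[1, a]] :|: [[b, c - 1]]) G
     * Delta_lo ([[1, a - 1]] :|: [[b + 1, c]]) G).

Definition Y_up G (a b c : nat) : R :=
  (Delta_up ([[a, b]] :|: [[c + 1, n]]) G
   * Delta_up ([[a + 1, b - 1]] :|: [[c, n]]) G)
  / (Delta_up ([[a, b - 1]] :|: [[c + 1, n]]) G
     * Delta_up ([[a + 1, b]] :|: [[c, n]]) G).

Definition Yt_up G (a b c : nat) : R :=
  (Delta_up ([[1, a]] :|: [[b, c - 1]]) G
   * Delta_up ([[1, a - 1]] :|: [[b + 1, c]]) G)
  / (Delta_up ([[1, a]] :|: [[b + 1, c - 1]]) G
     * Delta_up ([[1, a - 1]] :|: [[b, c]]) G).

End Minors.

(* Sum over the triples 1 <= a < b < c <= n. *)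
Definition sum_T (R : realType) (n : nat) (F : nat -> nat -> nat -> R) : R :=
  \sum_(1 <= a < n.+1) \sum_(a.+1 <= b < n.+1) \sum_(b.+1 <= c < n.+1) F a b c.

(* Main.v *)
Require Import Defs.
From HB Require Import structures.
From mathcomp Require Import all_boot all_order all_algebra.
From mathcomp Require Import all_classical all_reals all_analysis.
From mathcomp Require Import perm zify ring lra.

Set Implicit Arguments.
Unset Strict Implicit.
Unset Printing Implicit Defensive.

Import Order.TTheory GRing.Theory Num.Theory.
Import numFieldNormedType.Exports.

Local Open Scope ring_scope.

(* For K disjoint from {a,b,c} put
     u(abc;K) = P(Kab) P(Kc) / (P(Kb) P(Kac)),
   where P is one of the two families of flag minors and Kab stands for the union
   of K and {a,b}. By the three-term Pluecker relation, l(1/Y_abc) is a fixed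
   multiple of L(u(abc;K)) with K = [a+1,b-1] u [c+1,n], and l(1/Yt_abc) is the
   same multiple of L(u(abc;K)) with K = [1,a-1] u [b+1,c-1].
   For a < b < c < d outside K, two five-term relations for L sharing the term
   L(P(Kbc) P(Kad) / (P(Kac) P(Kbd))) give the "tetrahedron" identity
     L(u(abc;Kd)) + L(u(abd;K)) + L(u(acd;Kb)) + L(u(bcd;K))
     = L(u(abc;K)) + L(u(abd;Kc)) + L(u(acd;K)) + L(u(bcd;Ka)).
   Summed over all quadruples with K = [1,a-1] u [b+1,c-1] u [d+1,n] it telescopes
   to sum l(1/Y) = sum l(1/Yt), for lower and for upper minors. The lower and the
   upper sums agree because both are made of solid minors:
   Yt^abc = Y_(a,a+c-b,c). Finally G -> check G turns Y_lo into 1/Yt_lo, G -> hat G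
   turns Y_up into 1/Yt_up, up to reversing the labels, and l(x) + l(1/x) does not
   depend on x. Only the constancy of such sums of L matters, never the constant,
   so the functional equations of L follow by differentiation alone. *)

(** * The Rogers dilogarithm *)

Lemma is_derive0_cst_in (R : realType) (f : R -> R) (l u x y : R) :
  (forall z, l < z < u -> is_derive z 1 f 0) -> l < x < u -> l < y < u ->
  f x = f y.
Proof.
move=> df; wlog xy : x y / x <= y.
  move=> h lx ly; case: (leP x y) => [xy|/ltW yx]; first exact: h.
  by rewrite (h y x).
move=> /andP[lx xu] /andP[ly yu].
have zin z : z \in `[x, y] -> l < z < u.
  by rewrite in_itv /= => /andP[xz zy]; rewrite (lt_le_trans lx xz) (le_lt_trans zy yu).
have [z|z zxy|c _ /eqP] := @MVT_segment R f (fun=> 0) x y xy.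
- by move=> /subset_itv_oo_cc /zin; exact: df.
- apply: continuous_in_subspaceT z zxy => z; rewrite inE => /zin/df dfz.
  by apply: differentiable_continuous; apply/derivable1_diffP.
by rewrite mul0r subr_eq0 => /eqP ->.
Qed.

(** Comparison, at the midpoint s of |x| and 1, with a geometric series of ratio t between s and 1:
    by Bernoulli's inequality (t/s)^k dominates k + 1 up to the factor 1 + 1/h. The bound k + 1 is
    wide enough for the series of [dilog] and of the logarithm and for their first two derived
    series. *)
Lemma is_cvg_pseries_linear_coef (R : realType) (c : nat -> R) (x : R) :
  (forall k, `|c k| <= k.+1%:R) -> `|x| < 1 -> cvgn (pseries c x).
Proof.
move=> cle x1.
pose s : R := (1 + `|x|) / 2.
have s0 : 0 < s by rewrite /s; have := normr_ge0 x; lra.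
have s1 : s < 1 by rewrite /s; lra.
have xs : `|x| < s by rewrite /s; lra.
have sE : `|s| = s by rewrite gtr0_norm.
apply: (@is_cvg_pseries_inside _ _ s); last by rewrite sE.
pose t : R := (1 + s) / 2.
have t0 : 0 < t by rewrite /t; lra.
have st : s < t by rewrite /t; lra.
have t1 : t < 1 by rewrite /t; lra.
pose h : R := t / s - 1.
have h0 : 0 < h by rewrite /h subr_gt0 ltr_pdivlMr// mul1r.
have bern k : 1 + k%:R * h <= (t / s) ^+ k.
  elim: k => [|k IH]; first by rewrite mul0r addr0 expr0.
  have -> : t / s = 1 + h by rewrite /h addrC subrK.
  move: IH; have -> : t / s = 1 + h by rewrite /h addrC subrK.
  rewrite exprS -natr1 => IH.
  have k0 : 0 <= k%:R :> R by [].
  by apply: le_trans (ler_wpM2l _ IH); nra.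
apply: normed_cvg.
apply: (@series_le_cvg _ _ (geometric (1 + h^-1) t)).
- by move=> k; apply: normr_ge0.
- move=> k; rewrite /geometric /= mulr_ge0 ?exprn_ge0 ?addr_ge0 ?invr_ge0 ?ltW//.
- move=> k; rewrite /geometric /= normrM normrX sE.
  have -> : t ^+ k = (t / s) ^+ k * s ^+ k by rewrite -exprMn divfK ?lt0r_neq0.
  rewrite mulrA; apply: ler_wpM2r; first by rewrite exprn_ge0 ?ltW.
  apply: le_trans (cle k) _.
  have h1 : 0 <= 1 + h^-1 by rewrite addr_ge0 ?invr_ge0// ltW.
  apply: le_trans (ler_wpM2l h1 (bern k)).
  have -> : (1 + h^-1) * (1 + k%:R * h) = h^-1 + k%:R * h + k.+1%:R.
    by rewrite -natr1; field; rewrite lt0r_neq0.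
  by rewrite lerDr addr_ge0 ?invr_ge0 ?mulr_ge0// ltW.
- by apply: is_cvg_geometric_series; rewrite gtr0_norm.
Qed.

(** Termwise differentiation asks for convergence of the series and of its first two derived series
    at some point beyond |x|. *)
Lemma is_derive_pseries_linear_coef (R : realType) (c : nat -> R) (x : R) :
  (forall k, `|c k| <= k.+1%:R) ->
  (forall k, `|pseries_diffs c k| <= k.+1%:R) ->
  (forall k, `|pseries_diffs (pseries_diffs c) k| <= k.+1%:R) ->
  `|x| < 1 ->
  is_derive x 1 (fun y => limn (pseries c y)) (limn (pseries (pseries_diffs c) x)).
Proof.
move=> c0 c1 c2 x1; have x0 := normr_ge0 x.
have K0 : 0 < (1 + `|x|) / 2 by lra.
have KE : `|(1 + `|x|) / 2| = (1 + `|x|) / 2 :> R by rewrite gtr0_norm.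
have K1 : `|(1 + `|x|) / 2 : R| < 1 by rewrite KE; lra.
apply: (@pseries_snd_diffs _ _ ((1 + `|x|) / 2));
  try exact: is_cvg_pseries_linear_coef.
by rewrite KE; lra.
Qed.

Lemma is_derive_onem (R : realType) (x : R) :
  is_derive x 1 (fun y : R => 1 - y) (-1).
Proof.
have := @is_deriveB R R^o R^o (fun=> 1) id x 1 _ _ (is_derive_cst _ _ _)
  (is_derive_id _ _).
by rewrite sub0r.
Qed.

Lemma is_derive_ln_onem (R : realType) (x : R) : x < 1 ->
  is_derive x 1 (fun y : R => ln (1 - y)) (- (1 - x)^-1).
Proof.
rewrite -subr_gt0 => /is_derive1_ln d.
have := @is_derive1_comp R _ (fun y : R => 1 - y) _ _ _ d (is_derive_onem x).
by rewrite mulrN1.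
Qed.

(** Both sides vanish at 0 and have derivative 1/(1 - x). The term k = 0 is zero because 0^-1 =
    0. *)
Lemma pseries_invn (R : realType) (x : R) : `|x| < 1 ->
  limn (pseries (fun k => k%:R^-1) x) = - ln (1 - x).
Proof.
move=> x1.
pose N : R -> R := fun y => limn (pseries (fun k => k%:R^-1) y).
have dN (y : R) : `|y| < 1 -> is_derive y 1 N (1 - y)^-1.
  move=> y1.
  have d1 : pseries_diffs (fun k => k%:R^-1) = (fun=> 1 : R).
    by apply/funext => k; rewrite /pseries_diffs divff// pnatr_eq0.
  have <- : limn (pseries (pseries_diffs (fun k => k%:R^-1)) y) = (1 - y)^-1.
    rewrite d1; apply: cvg_lim => //.
    by have := @cvg_geometric_series R 1 y y1; rewrite mul1r; apply.
  apply: is_derive_pseries_linear_coef => //.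
  - move=> [|k]; first by rewrite invr0 normr0.
    rewrite ger0_norm ?invr_ge0//; apply: (@le_trans _ _ 1); last by rewrite ler1n.
    by rewrite invf_le1 ?ltr0n// ler1n.
  - by move=> k; rewrite d1 normr1 ler1n.
  - by move=> k; rewrite d1 /pseries_diffs mulr1 ger0_norm.
have N0 : N 0 = 0.
  apply: cvg_lim => //; apply: (@cvg_trans _ (cst (0 : R) @ \oo)%classic); last exact: cvg_cst.
  apply: near_eq_cvg; near=> n; rewrite /pseries /series /=.
  rewrite big1// => -[|k] _; first by rewrite invr0 mul0r.
  by rewrite expr0n mulr0.
have itvE (y : R) : -1 < y < 1 = (`|y| < 1) by rewrite ltr_norml.
have E : (N x + ln (1 - x)) = (N 0 + ln (1 - 0)).
  apply: (@is_derive0_cst_in R (fun y => N y + ln (1 - y)) (-1) 1); rewrite ?itvE ?normr0//.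
  move=> z; rewrite itvE => z1.
  have z0 : 0 < 1 - z by rewrite subr_gt0; move: z1; rewrite -itvE => /andP[].
  have dNz := dN z z1.
  have z1' : z < 1 by rewrite -subr_gt0.
  have dl := is_derive_ln_onem z1'.
  by apply: is_derive_eq; rewrite subrr.
by move: E; rewrite N0 subr0 ln1 addr0 => /eqP; rewrite addr_eq0 => /eqP.
Unshelve. all: by end_near. Qed.

(** The derived series, with coefficients 1/(k + 1), becomes the series of -ln(1 - x) after
    multiplication by x. *)
Lemma is_derive_dilog (R : realType) (x : R) : 0 < x < 1 ->
  is_derive x 1 (@dilog R) (- ln (1 - x) / x).
Proof.
move=> /andP[x0 x1].
have nx1 : `|x| < 1 by rewrite gtr0_norm.
pose c k : R := (k%:R ^+ 2)^-1.
have d1 : pseries_diffs c = (fun k => k.+1%:R^-1).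
  by apply/funext => k; rewrite /pseries_diffs /c expr2 invfM mulrA divff ?mul1r// pnatr_eq0.
have inv_le k : `|k.+1%:R^-1 : R| <= 1.
  by rewrite ger0_norm ?invr_ge0// invf_le1 ?ltr0n// ler1n.
have <- : limn (pseries (pseries_diffs c) x) = - ln (1 - x) / x.
  rewrite -pseries_invn//; apply: (mulIf (lt0r_neq0 x0)); rewrite divfK ?lt0r_neq0//.
  have cM : cvgn (pseries (pseries_diffs c) x).
    apply: is_cvg_pseries_linear_coef => // k.
    by rewrite d1; apply: le_trans (inv_le k) _; rewrite ler1n.
  have cN : cvgn (pseries (fun k => k%:R^-1) x).
    apply: is_cvg_pseries_linear_coef => // -[|k]; first by rewrite invr0 normr0.
    by apply: le_trans (inv_le k) _; rewrite ler1n.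
  (* The index shift is exact on partial sums because the summand k = 0 of the series with
     coefficients 1/k is 0. *)
  have cxM : ((fun n => pseries (fun k => k%:R^-1) x n.+1) @ \oo
      --> limn (pseries (pseries_diffs c) x) * x)%classic.
    rewrite (_ : (fun n => _) = (fun n => pseries (pseries_diffs c) x n * x)).
      exact: cvgMl.
    apply/funext => n; rewrite /pseries /series /=.
    rewrite d1 big_nat_recl//= invr0 mul0r add0r mulr_suml; apply: eq_bigr => k _.
    by rewrite exprS; ring.
  rewrite -(cvg_lim _ cxM)//; apply: cvg_lim => //.
  by move: cN; rewrite /= -cvg_shiftS.
apply: is_derive_pseries_linear_coef => // k.
- case: k => [|k]; first by rewrite /c expr0n invr0 normr0.
  rewrite /c ger0_norm ?invr_ge0 ?sqr_ge0//; apply: (@le_trans _ _ 1); last by rewrite ler1n.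
  by rewrite invf_le1 -natrX ?ltr0n// ler1n expn_gt0.
- by rewrite d1; apply: le_trans (inv_le k) _; rewrite ler1n.
- rewrite d1 /pseries_diffs normrM normr_nat ler_piMr//.
Qed.

Lemma is_derive_rogers (R : realType) (x : R) : 0 < x < 1 ->
  is_derive x 1 (@rogers_dilog R) (- 2^-1 * (ln (1 - x) / x + ln x / (1 - x))).
Proof.
move=> x01; have /andP[x0 x1] := x01.
have y0 : 0 < 1 - x by rewrite subr_gt0.
have dl := is_derive_ln_onem x1.
have dl' := is_derive1_ln x0.
have dd := is_derive_dilog x01.
apply: is_derive_eq.
rewrite /GRing.scale /=.
by field; rewrite !lt0r_neq0.
Qed.

Lemma is_derive_rogers_comp (R : realType) (f : R -> R) (x df : R) :
  is_derive x 1 f df -> 0 < f x < 1 ->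
  is_derive x 1 (fun y => rogers_dilog (f y))
    (- 2^-1 * (ln (1 - f x) * (df / f x) + ln (f x) * (df / (1 - f x)))).
Proof.
move=> hf f01; have hr := is_derive_rogers f01.
have := @is_derive1_comp R _ _ _ _ _ hr hf.
by move=> h; apply: (is_derive_eq h); ring.
Qed.

(** * Functional equations of the Rogers dilogarithm: reflection, pentagon, tetrahedron *)

Lemma rogers_reflection (R : realType) : exists C : R,
  forall x, 0 < x < 1 -> rogers_dilog x + rogers_dilog (1 - x) = C.
Proof.
pose f (x : R) := rogers_dilog x + rogers_dilog (1 - x).
exists (f 2^-1) => x x01.
apply: (@is_derive0_cst_in R f 0 1) => //; last by lra.
move=> z z01.
have d1 := is_derive_rogers z01.
have z01' : 0 < 1 - z < 1 by lra.
have d2 := is_derive_rogers_comp (is_derive_onem z) z01'.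
apply: is_derive_eq.
by rewrite subKr; field; apply/andP; split; lra.
Qed.

(** For fixed y, the composite arguments in the pentagon relation are Möbius functions of x. *)
Lemma is_derive_moebius (R : realType) (p q r s x : R) : r + s * x != 0 ->
  is_derive x 1 (fun y : R => (p + q * y) / (r + s * y))
    ((q * r - p * s) / (r + s * x) ^+ 2).
Proof.
move=> d0.
have aff (u v : R) : is_derive x 1 (fun y : R => u + v * y) v.
  have := @is_deriveD R R^o R^o (fun=> u) (fun y => v *: y) x 1 _ _
    (is_derive_cst _ _ _) (is_deriveZ v (is_derive_id _ _)).
  by rewrite add0r /GRing.scale /= mulr1.
have := @is_deriveM R R^o (fun y => p + q * y) (fun y => (r + s * y)^-1) x 1 _ _
  (aff p q) (@is_deriveV R _ x _ 1 d0 (aff r s)).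
move=> h; apply: (is_derive_eq h).
by rewrite /GRing.scale /=; field.
Qed.

(** The sum is symmetric in x and y, so constancy in x for fixed y suffices. All five arguments and
    their complements to 1 are products of powers of x, y, 1 - x, 1 - y and 1 - xy; once the
    logarithms are expanded accordingly, the derivative in x cancels as a rational identity. *)
Lemma rogers_pentagon (R : realType) : exists C : R,
  forall x y, 0 < x < 1 -> 0 < y < 1 ->
  rogers_dilog x + rogers_dilog y + rogers_dilog (1 - x * y)
  + rogers_dilog ((1 - x) / (1 - x * y))
  + rogers_dilog ((1 - y) / (1 - x * y)) = C.
Proof.
pose F (x y : R) := rogers_dilog x + rogers_dilog y + rogers_dilog (1 - x * y)
  + rogers_dilog ((1 - x) / (1 - x * y))
  + rogers_dilog ((1 - y) / (1 - x * y)).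
have FC x y : F x y = F y x by rewrite /F [y * x]mulrC; ring.
suff cst x x' y : 0 < x < 1 -> 0 < x' < 1 -> 0 < y < 1 -> F x y = F x' y.
  have h01 : 0 < (2^-1 : R) < 1 by rewrite invr_gt0 invf_lt1 ?ltr0n ?ltr1n.
  exists (F 2^-1 2^-1) => x y x01 y01; rewrite -/(F x y).
  by rewrite (cst x 2^-1)// FC (cst y 2^-1).
move=> x01 x'01 /[dup] y01 /andP[y0 y1].
apply: (@is_derive0_cst_in R (F ^~ y) 0 1) => // {x01 x'01} {}x /[dup] x01 /andP[x0 x1].
have x1' : 0 < 1 - x by rewrite subr_gt0.
have y1' : 0 < 1 - y by rewrite subr_gt0.
have xy0 : 0 < x * y by rewrite mulr_gt0.
have xy1 : 0 < 1 - x * y by nra.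
have nx1' := lt0r_neq0 x1'. have ny1' := lt0r_neq0 y1'.
have nxy1 := lt0r_neq0 xy1. have nx := lt0r_neq0 x0. have ny := lt0r_neq0 y0.
have den0 : 1 + (- y) * x != 0 by rewrite (_ : 1 + _ = 1 - x * y)//; ring.
have num0 : 1 + 0 * x != 0 :> R by rewrite mul0r addr0 oner_neq0.
have d1 := is_derive_rogers x01.
have d2 : is_derive x 1 (fun x => rogers_dilog (1 - x * y))
    (- 2^-1 * ((ln x + ln y) * (- y / (1 - x * y)) + ln (1 - x * y) * (- y / (x * y)))).
  have e : (fun z => (1 + (- y) * z) / (1 + 0 * z)) = (fun z => 1 - z * y).
    by apply/funext => z; rewrite mul0r addr0 divr1; ring.
  have := is_derive_moebius 1 (- y) num0; rewrite e => h.
  have h2 := is_derive_rogers_comp h _; apply: (is_derive_eq (h2 _)).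
    by rewrite xy1 ltrBlDr ltrDl.
  rewrite subKr lnM ?posrE// mul0r mulr0 subr0 mulr1 addr0 expr1n divr1.
  done.
have d3 : is_derive x 1 (fun x => rogers_dilog ((1 - x) / (1 - x * y)))
    (- 2^-1 * ((ln x + ln (1 - y) - ln (1 - x * y)) * (- (1 - y) / ((1 - x * y) * (1 - x)))
       + (ln (1 - x) - ln (1 - x * y)) * (- 1 / (x * (1 - x * y))))).
  have e : (fun z => (1 + (-1) * z) / (1 + (- y) * z)) = (fun z => (1 - z) / (1 - z * y)).
    by apply/funext => z; congr (_ / _); ring.
  have := is_derive_moebius 1 (-1) den0; rewrite e => h.
  have of_ : 1 - (1 - x) / (1 - x * y) = x * (1 - y) / (1 - x * y) by field.
  have h2 := is_derive_rogers_comp h _; apply: (is_derive_eq (h2 _)).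
    by rewrite divr_gt0//= -subr_gt0 of_ divr_gt0 ?mulr_gt0.
  rewrite of_ !ln_div ?posrE ?mulr_gt0// lnM ?posrE//.
  by field; rewrite !(nxy1, nx, ny, nx1', ny1').
have d4 : is_derive x 1 (fun x => rogers_dilog ((1 - y) / (1 - x * y)))
    (- 2^-1 * ((ln y + ln (1 - x) - ln (1 - x * y)) * (y / (1 - x * y))
       + (ln (1 - y) - ln (1 - x * y)) * ((1 - y) / ((1 - x) * (1 - x * y))))).
  have e : (fun z => (1 - y + 0 * z) / (1 + (- y) * z)) = (fun z => (1 - y) / (1 - z * y)).
    by apply/funext => z; congr (_ / _); ring.
  have := is_derive_moebius (1 - y) 0 den0; rewrite e => h.
  have of_ : 1 - (1 - y) / (1 - x * y) = y * (1 - x) / (1 - x * y) by field.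
  have h2 := is_derive_rogers_comp h _; apply: (is_derive_eq (h2 _)).
    by rewrite divr_gt0//= -subr_gt0 of_ divr_gt0 ?mulr_gt0.
  rewrite of_ !ln_div ?posrE ?mulr_gt0// lnM ?posrE//.
  by field; rewrite !(nxy1, nx, ny, nx1', ny1').
apply: is_derive_eq.
by field; rewrite nxy1 ny nx nx1'.
Qed.

(** Here [ab] stands for P(Kab), and so on. The first four equations are the three-term relations
    over K, the last four those over Kd, Kc, Kb and Ka. *)
Lemma rogers_tetrahedron (R : realType)
    (a b c d ab ac ad bc bd cd abc abd acd bcd : R) :
  0 < a -> 0 < b -> 0 < c -> 0 < d ->
  0 < ab -> 0 < ac -> 0 < ad -> 0 < bc -> 0 < bd -> 0 < cd ->
  0 < abc -> 0 < abd -> 0 < acd -> 0 < bcd ->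
  b * ac = a * bc + c * ab -> b * ad = a * bd + d * ab ->
  c * ad = a * cd + d * ac -> c * bd = b * cd + d * bc ->
  bd * acd = ad * bcd + cd * abd -> bc * acd = ac * bcd + cd * abc ->
  bc * abd = ab * bcd + bd * abc -> ac * abd = ab * acd + ad * abc ->
  rogers_dilog (abd * cd / (bd * acd)) + rogers_dilog (ab * d / (b * ad))
  + rogers_dilog (abc * bd / (bc * abd)) + rogers_dilog (bc * d / (c * bd))
  = rogers_dilog (ab * c / (b * ac)) + rogers_dilog (abc * cd / (bc * acd))
  + rogers_dilog (ac * d / (c * ad)) + rogers_dilog (abc * ad / (ac * abd)).
Proof.
move=> a0 b0 c0 d0 ab0 ac0 ad0 bc0 bd0 cd0 abc0 abd0 acd0 bcd0.
move=> r1 r2 r3 r4 r5 r6 r7 r8.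
have [C2 refl] := rogers_reflection R; have [C5 pent] := rogers_pentagon R.
(* A three-term relation places u = xy/(zt) in (0, 1) and makes its complement 1 - u the monomial
   pq/(zt). *)
have frac (x y z t p q : R) : 0 < x -> 0 < y -> 0 < z -> 0 < t -> 0 < p -> 0 < q ->
    z * t = p * q + x * y ->
    0 < x * y / (z * t) < 1 /\ 1 - x * y / (z * t) = p * q / (z * t).
  move=> x0 y0 z0 t0 p0 q0 e.
  have zt0 : 0 < z * t by rewrite mulr_gt0.
  split; first by rewrite divr_gt0 ?mulr_gt0//= ltr_pdivrMr// mul1r e ltrDr mulr_gt0.
  have -> : p * q = z * t - x * y by rewrite e; ring.
  by field; rewrite !lt0r_neq0.
have [h1 e1] := frac ab c b ac a bc ab0 c0 b0 ac0 a0 bc0 ltac:(rewrite r1; ring).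
have [h2 e2] := frac ab d b ad a bd ab0 d0 b0 ad0 a0 bd0 ltac:(rewrite r2; ring).
have [h3 e3] := frac ac d c ad a cd ac0 d0 c0 ad0 a0 cd0 ltac:(rewrite r3; ring).
have [h4 e4] := frac bc d c bd b cd bc0 d0 c0 bd0 b0 cd0 ltac:(rewrite r4; ring).
have [h5 e5] := frac abd cd bd acd ad bcd abd0 cd0 bd0 acd0 ad0 bcd0 ltac:(rewrite r5; ring).
have [h6 e6] := frac abc cd bc acd ac bcd abc0 cd0 bc0 acd0 ac0 bcd0 ltac:(rewrite r6; ring).
have [h7 e7] := frac abc bd bc abd ab bcd abc0 bd0 bc0 abd0 ab0 bcd0 ltac:(rewrite r7; ring).
have [h8 e8] := frac abc ad ac abd ab acd abc0 ad0 ac0 abd0 ab0 acd0 ltac:(rewrite r8; ring).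
have h2' : 0 < 1 - ab * d / (b * ad) < 1 by move: h2; lra.
have h4' : 0 < 1 - bc * d / (c * bd) < 1 by move: h4; lra.
(* The two pentagons start from the pairs u(abc;Kd), u(acd;Kb) and 1 - u(abd;K), 1 - u(bcd;K). The
   rewrites below identify their other arguments; both contain P(Kbc) P(Kad) / (P(Kac) P(Kbd)),
   whose terms cancel on subtraction. *)
have := pent _ _ h5 h7; have := pent _ _ h2' h4'.
rewrite !subKr.
have -> : 1 - (1 - ab * d / (b * ad)) * (1 - bc * d / (c * bd)) = ac * d / (c * ad).
  rewrite e2 e4 -[RHS](subKr 1) e3; congr (1 - _).
  by field; rewrite !lt0r_neq0.
have -> : 1 - abd * cd / (bd * acd) * (abc * bd / (bc * abd)) = 1 - abc * cd / (bc * acd).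
  by congr (1 - _); field; rewrite !lt0r_neq0.
have -> : ab * d / (b * ad) / (ac * d / (c * ad)) = ab * c / (b * ac).
  by field; rewrite !lt0r_neq0.
have -> : (1 - abc * bd / (bc * abd)) / (1 - abc * cd / (bc * acd))
    = 1 - abc * ad / (ac * abd).
  by rewrite e7 e6 e8; field; rewrite !lt0r_neq0.
have -> : (1 - abd * cd / (bd * acd)) / (1 - abc * cd / (bc * acd))
    = bc * d / (c * bd) / (ac * d / (c * ad)).
  by rewrite e5 e6; field; rewrite !lt0r_neq0.
(* Reflection trades the four arguments of the form 1 - u for u; all constants then cancel. *)
have := refl _ h2; have := refl _ h4; have := refl _ h6; have := refl _ h8.
lra.
Qed.

(** * Telescoping the tetrahedron identity *)

Section SumsOverTuples.
Variables (R : realType) (n : nat).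

(** The order conditions sit in the summand and not in the ranges, so that the four sums can be
    exchanged freely. *)
Definition sum4 (F : nat -> nat -> nat -> nat -> R) : R :=
  \sum_(1 <= a < n.+1) \sum_(1 <= b < n.+1) \sum_(1 <= c < n.+1)
    \sum_(1 <= d < n.+1) if [&& a < b, b < c & c < d]%N then F a b c d else 0.

Lemma sum_TE (F : nat -> nat -> nat -> R) : sum_T n F =
  \sum_(1 <= a < n.+1) \sum_(1 <= b < n.+1) \sum_(1 <= c < n.+1)
    if [&& a < b & b < c]%N then F a b c else 0.
Proof.
rewrite /sum_T; apply: eq_big_nat => a _.
rewrite (@big_nat_widenl _ _ _ _ 1)//= big_mkcond; apply: eq_big_nat => b _ /=.
case: ifP => ab; last by rewrite big1.
by rewrite (@big_nat_widenl _ _ _ _ 1)//= big_mkcond.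
Qed.

Lemma eq_sum_T (F F' : nat -> nat -> nat -> R) :
  (forall a b c, (0 < a)%N -> (a < b)%N -> (b < c)%N -> (c <= n)%N ->
    F a b c = F' a b c) ->
  sum_T n F = sum_T n F'.
Proof.
move=> e; rewrite !sum_TE.
apply: eq_big_nat => a ha; apply: eq_big_nat => b hb; apply: eq_big_nat => c hc.
by case: ifP => // /andP[ab bc]; apply: e => //; lia.
Qed.

Lemma sum_TD (F F' : nat -> nat -> nat -> R) :
  sum_T n (fun a b c => F a b c + F' a b c) = sum_T n F + sum_T n F'.
Proof.
rewrite /sum_T -big_split; apply: eq_bigr => a _; rewrite -big_split.
by apply: eq_bigr => b _; rewrite -big_split.
Qed.

Lemma telescope_sum_if (g : nat -> R) (l u : nat) : (l < u <= n.+1)%N ->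
  \sum_(1 <= e < n.+1) (if (l < e < u)%N then g e - g e.+1 else 0)
  = g l.+1 - g u.
Proof.
move=> /andP[lu un].
have := telescope_sumr g lu => /(congr1 -%R); rewrite opprB => <-.
rewrite -sumrN (@big_nat_widenl _ _ _ l.+1 1)//= (big_nat_widen _ _ _ _ _ un).
rewrite [RHS]big_mkcond; apply: eq_bigr => e _ /=.
by case: ifP => //; rewrite ?opprB.
Qed.

(** In this lemma and the next three, the last argument of [f] is the vertex summed out. It runs
    through the gap between its neighbours, or up to n, or down from its neighbour to 1, and only
    the values at the two ends survive. *)
Lemma sum4_telescope_last (f : nat -> nat -> nat -> nat -> R) :
  sum4 (fun a b c d => f a b c d - f a b c d.+1)
  = sum_T n (fun a b c => f a b c c.+1 - f a b c n.+1).
Proof.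
rewrite sum_TE; apply: eq_big_nat => a ha; apply: eq_big_nat => b hb.
apply: eq_big_nat => c hc.
have [/andP[ab bc]|abc] := boolP (a < b < c)%N; last first.
  by rewrite big1 // => d _; rewrite andbA (negbTE abc).
rewrite -(@telescope_sum_if (f a b c) c n.+1); last by lia.
by apply: eq_big_nat => d hd; rewrite ab bc; congr (if _ then _ else _); lia.
Qed.

Lemma sum4_telescope_third (f : nat -> nat -> nat -> nat -> R) :
  sum4 (fun a b c d => f a b d c - f a b d c.+1)
  = sum_T n (fun a b d => f a b d b.+1 - f a b d d).
Proof.
rewrite sum_TE; apply: eq_big_nat => a ha; apply: eq_big_nat => b hb.
rewrite exchange_big /=; apply: eq_big_nat => d hd.
have [/andP[ab bd]|abd] := boolP (a < b < d)%N; last first.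
  rewrite big1 // => c _; case: ifP => // /and3P[ab bc cd].
  by rewrite ab (ltn_trans bc cd) in abd.
rewrite -(@telescope_sum_if (f a b d) b d); last by lia.
by apply: eq_big_nat => c hc; rewrite ab.
Qed.

Lemma sum4_telescope_second (f : nat -> nat -> nat -> nat -> R) :
  sum4 (fun a b c d => f a c d b - f a c d b.+1)
  = sum_T n (fun a c d => f a c d a.+1 - f a c d c).
Proof.
rewrite sum_TE; apply: eq_big_nat => a ha.
rewrite exchange_big /=; apply: eq_big_nat => c hc.
rewrite exchange_big /=; apply: eq_big_nat => d hd.
have [/andP[ac cd]|acd] := boolP (a < c < d)%N; last first.
  rewrite big1 // => b _; case: ifP => // /and3P[ab bc cd].
  by rewrite cd (ltn_trans ab bc) in acd.
rewrite -(@telescope_sum_if (f a c d) a c); last by lia.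
by apply: eq_big_nat => b hb; rewrite cd andbT.
Qed.

Lemma sum4_telescope_first (f : nat -> nat -> nat -> nat -> R) :
  sum4 (fun a b c d => f b c d a - f b c d a.+1)
  = sum_T n (fun b c d => f b c d 1%N - f b c d b).
Proof.
rewrite sum_TE /sum4 exchange_big /=; apply: eq_big_nat => b hb.
rewrite exchange_big /=; apply: eq_big_nat => c hc.
rewrite exchange_big /=; apply: eq_big_nat => d hd.
have [/andP[bc cd]|] := boolP (b < c < d)%N; last first.
  by rewrite big1 // => a _; rewrite andbF.
rewrite -(@telescope_sum_if (f b c d) 0 b); last by lia.
by apply: eq_big_nat => a /andP[-> _]; rewrite andbT.
Qed.

End SumsOverTuples.

(** * The tetrahedron identity for Plücker coordinates and its sum over quadruples *)

Section PluckerSums.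
Variables (R : realType) (n : nat).
Implicit Types (P : {set 'I_n} -> R) (S : {set 'I_n}) (K : pred nat).

(** All that the telescoping argument uses about either family of flag minors. *)
Definition plucker_positive P : Prop :=
  (forall S, 0 < P S) /\
  forall S (a b c : 'I_n), (a < b)%N -> (b < c)%N ->
    a \notin S -> b \notin S -> c \notin S ->
    P (b |: S) * P (a |: (c |: S))
    = P (a |: S) * P (b |: (c |: S)) + P (c |: S) * P (a |: (b |: S)).

(** This is u(abc;S). *)
Definition flip_ratio P S (a b c : 'I_n) : R :=
  P (a |: (b |: S)) * P (c |: S) / (P (b |: S) * P (a |: (c |: S))).

Lemma flip_ratio_tetrahedron P S (a b c d : 'I_n) : plucker_positive P ->
  (a < b)%N -> (b < c)%N -> (c < d)%N ->
  a \notin S -> b \notin S -> c \notin S -> d \notin S ->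
  rogers_dilog (flip_ratio P (d |: S) a b c) + rogers_dilog (flip_ratio P S a b d)
  + rogers_dilog (flip_ratio P (b |: S) a c d) + rogers_dilog (flip_ratio P S b c d)
  = rogers_dilog (flip_ratio P S a b c) + rogers_dilog (flip_ratio P (c |: S) a b d)
  + rogers_dilog (flip_ratio P S a c d) + rogers_dilog (flip_ratio P (a |: S) b c d).
Proof.
move=> [P0 Pl] ab bc cd aS bS cS dS.
have ac := ltn_trans ab bc; have ad := ltn_trans ac cd; have bd := ltn_trans bc cd.
have ne (x y : 'I_n) : (x < y)%N -> (x == y = false) * (y == x = false).
  by move=> xy; rewrite [y == x]eq_sym -val_eqE ltn_eqF.
have nE := (ne _ _ ab, ne _ _ bc, ne _ _ cd, ne _ _ ac, ne _ _ ad, ne _ _ bd).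
have nin (x y : 'I_n) : x == y = false -> x \notin S -> x \notin y |: S.
  by move=> xy xS; rewrite in_setU1 xy.
have swap (x y : 'I_n) T : x |: (y |: T) = y |: (x |: T) by rewrite finset.setUCA.
(* Listing the added labels in increasing order gives each union a single normal form, so equal
   coordinates become syntactically equal. *)
have sorted_union := (swap b a, swap c a, swap d a, swap c b, swap d b, swap d c).
have := Pl (d |: S) a b c ab bc; have := Pl (c |: S) a b d ab bd.
have := Pl (b |: S) a c d ac cd; have := Pl (a |: S) b c d bc cd.
rewrite !(nin, nE)// => /(_ isT isT isT) q1 /(_ isT isT isT) q2.
move=> /(_ isT isT isT) q3 /(_ isT isT isT) q4.
have := rogers_tetrahedron (P0 (a |: S)) (P0 (b |: S)) (P0 (c |: S)) (P0 (d |: S))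
  (P0 (a |: (b |: S))) (P0 (a |: (c |: S))) (P0 (a |: (d |: S)))
  (P0 (b |: (c |: S))) (P0 (b |: (d |: S))) (P0 (c |: (d |: S)))
  (P0 (a |: (b |: (c |: S)))) (P0 (a |: (b |: (d |: S))))
  (P0 (a |: (c |: (d |: S)))) (P0 (b |: (c |: (d |: S))))
  (Pl _ _ _ _ ab bc aS bS cS) (Pl _ _ _ _ ab bd aS bS dS)
  (Pl _ _ _ _ ac cd aS cS dS) (Pl _ _ _ _ bc cd bS cS dS).
move: q1 q2 q3 q4.
rewrite !sorted_union => q1 q2 q3 q4.
rewrite /flip_ratio !sorted_union => -> //.
Qed.

(** Sets given by predicates on 1-based labels: equality of two of them reduces to linear arithmetic
    on labels between 1 and n. [label_ratio] is u(abc;K) in this form. *)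
Definition label_set K : {set 'I_n} := [set i : 'I_n | K i.+1].

Definition label_ratio P K (a b c : nat) : R :=
  P (label_set [pred e | [|| e == a, e == b | K e]])
  * P (label_set [pred e | (e == c) || K e])
  / (P (label_set [pred e | (e == b) || K e])
     * P (label_set [pred e | [|| e == a, e == c | K e]])).

Lemma eq_label_ratio P K K' a b c :
  (forall e, (0 < e <= n)%N -> K e = K' e) ->
  label_ratio P K a b c = label_ratio P K' a b c.
Proof.
move=> e; have E (p q : pred nat) :
    (forall e, (0 < e <= n)%N -> p e = q e) -> label_set p = label_set q.
  by move=> h; apply/setP => i; rewrite !inE h //= ltn_ord.
by congr (P _ * P _ / (P _ * P _)); apply: E => x xn; rewrite /= e.
Qed.

Lemma label_ratioE P K (a b c : 'I_n) :
  label_ratio P K a.+1 b.+1 c.+1 = flip_ratio P (label_set K) a b c.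
Proof.
by congr (P _ * P _ / (P _ * P _)); apply/setP => i; rewrite !inE ?eqSS -?val_eqE.
Qed.

Lemma label_ratio_tetrahedron P K (a b c d : nat) : plucker_positive P ->
  (0 < a)%N -> (a < b)%N -> (b < c)%N -> (c < d)%N -> (d <= n)%N ->
  ~~ K a -> ~~ K b -> ~~ K c -> ~~ K d ->
  rogers_dilog (label_ratio P [pred e | (e == d) || K e] a b c)
  + rogers_dilog (label_ratio P K a b d)
  + rogers_dilog (label_ratio P [pred e | (e == b) || K e] a c d)
  + rogers_dilog (label_ratio P K b c d)
  = rogers_dilog (label_ratio P K a b c)
  + rogers_dilog (label_ratio P [pred e | (e == c) || K e] a b d)
  + rogers_dilog (label_ratio P K a c d)
  + rogers_dilog (label_ratio P [pred e | (e == a) || K e] b c d).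
Proof.
move=> Pp; case: a => // a _; case: b => // b ab; case: c => // c bc.
case: d => // d cd dn Ka Kb Kc Kd.
have [an bn cn] : [/\ (a < n)%N, (b < n)%N & (c < n)%N] by split; lia.
have := @flip_ratio_tetrahedron P (label_set K) (Ordinal an) (Ordinal bn)
  (Ordinal cn) (Ordinal dn) Pp ab bc cd.
rewrite !inE => /(_ Ka Kb Kc Kd).
have lset (x : 'I_n) : x |: label_set K = label_set [pred e | (e == x.+1) || K e].
  by apply/setP => i; rewrite !inE eqSS -val_eqE.
by rewrite !lset -!label_ratioE.
Qed.

(** Since labels are positive and at most n, the first block is empty for p = 0 and the last one for
    s = n + 1. *)
Definition three_blocks (p q r s : nat) : pred nat :=
  fun e => [|| e <= p, q <= e <= r | s <= e]%N.

Lemma sum_label_ratio P : plucker_positive P ->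
  sum_T n (fun a b c =>
    rogers_dilog (label_ratio P (three_blocks 0 a.+1 b.-1 c.+1) a b c))
  = sum_T n (fun a b c =>
    rogers_dilog (label_ratio P (three_blocks a.-1 b.+1 c.-1 n.+1) a b c)).
Proof.
move=> Pp.
pose L p q r s a b c := rogers_dilog (label_ratio P (three_blocks p q r s) a b c).
have eqL p q r s p' q' r' s' a b c :
    (forall e, (0 < e <= n)%N -> three_blocks p q r s e = three_blocks p' q' r' s' e) ->
    L p q r s a b c = L p' q' r' s' a b c.
  by move=> h; congr (rogers_dilog _); apply: eq_label_ratio.
(* With K = [1,a-1] u [b+1,c-1] u [d+1,n], adding one vertex to K moves one block border by one.
   Each difference of [f] at a vertex and at its successor therefore pairs two terms of the
   tetrahedron identity on the same triple. *)
pose fd a b c d := L a.-1 b.+1 c.-1 d a b c.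
pose fc a b d c := L a.-1 b.+1 c.-1 d.+1 a b d.
pose fb a c d b := L a.-1 b c.-1 d.+1 a c d.
pose fa b c d a := L a.-1 b.+1 c.-1 d.+1 b c d.
have local : sum4 n (fun a b c d => (fd a b c d - fd a b c d.+1)
   + (fc a b d c - fc a b d c.+1) + (fb a c d b - fb a c d b.+1)
   + (fa b c d a - fa b c d a.+1)) = 0.
  rewrite /sum4 big_nat big1 // => a an; rewrite big_nat big1 // => b bn.
  rewrite big_nat big1 // => c cn; rewrite big_nat big1 // => d dn.
  case: ifP => // /and3P[ab bc cd].
  pose K := three_blocks a.-1 b.+1 c.-1 d.+1.
  have := @label_ratio_tetrahedron P K a b c d Pp.
  have KE x : (0 < x)%N -> K x = [|| x < a, b < x < c | d < x]%N.
    by move=> x0; rewrite /K /three_blocks; lia.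
  rewrite !KE; try lia.
  move=> /(_ ltac:(lia) ab bc cd ltac:(lia) ltac:(lia) ltac:(lia) ltac:(lia) ltac:(lia)).
  have Lp (K' : pred nat) p q r s x y z :
      (forall e, (0 < e <= n)%N -> K' e = three_blocks p q r s e) ->
      rogers_dilog (label_ratio P K' x y z) = L p q r s x y z.
    by move=> h; congr (rogers_dilog _); apply: eq_label_ratio.
  rewrite (Lp [pred e | (e == d) || K e] a.-1 b.+1 c.-1 d); last first.
    by move=> e /= _; rewrite /K /three_blocks; lia.
  rewrite (Lp [pred e | (e == b) || K e] a.-1 b c.-1 d.+1); last first.
    by move=> e /= _; rewrite /K /three_blocks; lia.
  rewrite (Lp [pred e | (e == c) || K e] a.-1 b.+1 c d.+1); last first.
    by move=> e /= _; rewrite /K /three_blocks; lia.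
  rewrite (Lp [pred e | (e == a) || K e] a b.+1 c.-1 d.+1); last first.
    by move=> e /= _; rewrite /K /three_blocks; lia.
  rewrite /fd /fc /fb /fa -/(L _ _ _ _ _ _ _) /K.
  rewrite -!/(L _ _ _ _ _ _ _) /=; lra.
have sum4D (F F' : nat -> nat -> nat -> nat -> R) :
    sum4 n (fun a b c d => F a b c d + F' a b c d) = sum4 n F + sum4 n F'.
  rewrite /sum4 -big_split; apply: eq_bigr => a _; rewrite -big_split.
  apply: eq_bigr => b _; rewrite -big_split; apply: eq_bigr => c _.
  by rewrite -big_split; apply: eq_bigr => d _ /=; case: ifP; rewrite ?addr0.
move: local; rewrite 3!sum4D (sum4_telescope_last n fd) (sum4_telescope_third n fc).
rewrite (sum4_telescope_second n fb) (sum4_telescope_first n fa) -!sum_TD => S0.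
have sum_TN (F : nat -> nat -> nat -> R) :
    - sum_T n F = sum_T n (fun a b c => - F a b c).
  rewrite /sum_T -sumrN; apply: eq_bigr => a _.
  by rewrite -sumrN; apply: eq_bigr => b _; rewrite -sumrN.
apply/eqP; rewrite -subr_eq0; apply/eqP; rewrite -{}S0 sum_TN.
rewrite -sum_TD; apply: eq_sum_T => x y z x0 xy yz zn.
rewrite /fd /fc /fb /fa -!/(L _ _ _ _ _ _ _) /=.
(* The end terms cancel except the two wanted ones and a pair that differs only in how the empty
   middle block is written. *)
rewrite (eqL x.-1 y y.-1 z.+1 x.-1 y.+1 y z.+1); last first.
  by move=> e _; rewrite /three_blocks; lia.
ring.
Qed.

End PluckerSums.

(** * Flag minors *)

Section RowDeterminants.
Variable R : fieldType.
Implicit Types (x y z : nat -> R) (s : seq (nat -> R)).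

Definition ndet (k : nat) (A : nat -> nat -> R) : R := \det (\matrix_(i < k, j < k) A i j).

Lemma eq_ndet k (A B : nat -> nat -> R) :
  (forall i j, (i < k)%N -> (j < k)%N -> A i j = B i j) -> ndet k A = ndet k B.
Proof. by move=> AB; congr (\det _); apply/matrixP => i j; rewrite !mxE AB. Qed.

(** A row is a function on all of nat, cut off at the number of rows, so one row can enter
    determinants of different sizes, as the Plücker relation requires. *)
Definition rdet s : R := ndet (size s) (nth (fun=> 0) s).

Lemma rdet_swap s1 s2 x y : rdet (s1 ++ x :: y :: s2) = - rdet (s1 ++ y :: x :: s2).
Proof.
rewrite /rdet !size_cat /=; set k := (_ + _)%N.
have h1 : (size s1 < k)%N by rewrite /k; lia.
have h2 : ((size s1).+1 < k)%N by rewrite /k; lia.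
pose p := Ordinal h1; pose q := Ordinal h2.
have pq : p != q by rewrite -val_eqE /= neq_ltn ltnSn.
rewrite /ndet (_ : (\matrix_(i, j) nth (fun=> 0) (s1 ++ x :: y :: s2) i j) =
   xrow p q (\matrix_(i < k, j < k) nth (fun=> 0) (s1 ++ y :: x :: s2) i j)).
  by rewrite xrowE det_mulmx det_perm odd_tperm pq expr1 mulN1r.
apply/matrixP => i j; rewrite !mxE !nth_cat.
case: tpermP => [->|->|/eqP ip /eqP iq] /=.
- by rewrite ltnn subnn ltnNge leqnSn /= subSnn.
- by rewrite ltnn subnn ltnNge leqnSn /= subSnn.
- case: ltnP => // si; move: ip iq; rewrite -!val_eqE /= => ip iq.
  by have -> : (i - size s1 = (i - (size s1).+2).+2)%N by lia.
Qed.

Lemma rdet_move s1 s2 s3 x :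
  rdet (s1 ++ s2 ++ x :: s3) = (-1) ^+ size s2 * rdet (s1 ++ x :: s2 ++ s3).
Proof.
elim/last_ind: s2 s3 => [|s2 y IH] s3; first by rewrite mul1r.
rewrite cat_rcons catA rdet_swap -catA IH size_rcons exprSr mulrN1 mulNr.
by rewrite cat_rcons.
Qed.

(* The cofactors of the first row of [x :: s]; they do not depend on [x]. *)
Definition rcofactor s (j : nat) : R :=
  (-1) ^+ j * ndet (size s) (fun i l => nth (fun=> 0) s i (bump j l)).

Lemma rdet_cons s x : rdet (x :: s) = \sum_(j < (size s).+1) x j * rcofactor s j.
Proof.
rewrite /rdet /ndet (expand_det_row _ ord0); apply: eq_bigr => j _.
rewrite mxE /= /cofactor add0n /rcofactor; congr (_ * (_ * \det _)).
by apply/matrixP => i l; rewrite !mxE.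
Qed.

Lemma rdet_dup s i : (i < size s)%N -> rdet (nth (fun=> 0) s i :: s) = 0.
Proof.
move=> si; rewrite /rdet /ndet.
apply: (@determinant_alternate _ _ _ ord0 (lift ord0 (Ordinal si))) => //.
by move=> j; rewrite !mxE.
Qed.

(* The matrix with rows x, y, z, s on the first [size s + 2] columns, bordered by
   the column of the determinants [rdet (r :: s)] over its rows r, is singular:
   by the expansion along r, that column is a combination of the others. *)
Lemma rdet_plucker s x y z :
  rdet (y :: s) * rdet (x :: z :: s)
  = rdet (x :: s) * rdet (y :: z :: s) + rdet (z :: s) * rdet (x :: y :: s).
Proof.
pose k := size s; pose t := [:: x, y, z & s].
pose row i := nth (fun=> 0) t i.
pose N := \matrix_(i < k.+3, j < k.+3)
  if (j : nat) is j'.+1 then row i j' else rdet (row i :: s).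
have detN0 : \det N = 0.
  apply/eqP; rewrite -det_tr; apply/det0P.
  pose v := \row_(j < k.+3) if (j : nat) is j'.+1 then
    (if (j' <= k)%N then rcofactor s j' else 0) else -1.
  exists v.
    by apply/eqP => /rowP /(_ ord0); rewrite !mxE /= => /eqP; rewrite oppr_eq0 oner_eq0.
  apply/rowP => i; rewrite !mxE big_ord_recl !mxE /= mulN1r.
  rewrite big_ord_recr !mxE /= ltnn mul0r addr0 addrC.
  apply/eqP; rewrite subr_eq0; apply/eqP; rewrite rdet_cons.
  by apply: eq_bigr => j _; rewrite !mxE /= -ltnS ltn_ord mulrC.
have : \det N = rdet (x :: s) * rdet (y :: z :: s) - rdet (y :: s) * rdet (x :: z :: s)
     + rdet (z :: s) * rdet (x :: y :: s).
  (* In the bordering column, a row r taken from s contributes [rdet (r :: s)], which vanishes by a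
     repeated row; only x, y and z remain. *)
  rewrite (expand_det_col _ ord0) 3!big_ord_recl big1 => [|i _]; last first.
    by rewrite mxE /= /bump /= /row /= rdet_dup ?mul0r ?ltn_ord.
  have minorE (i : 'I_k.+3) (r : seq (nat -> R)) : size r = k.+2 ->
      (forall l : 'I_k.+2, nth (fun=> 0) r l = row (lift i l)) ->
      cofactor N i ord0 = (-1) ^+ i * rdet r.
    move=> rk rE; rewrite /cofactor addn0 /rdet rk; congr (_ * \det _).
    by apply/matrixP => l j; rewrite !mxE /= rE.
  rewrite (minorE _ [:: y, z & s])//.
  rewrite (minorE _ [:: x, z & s])//; last by case=> [[|l] hl].
  rewrite (minorE _ [:: x, y & s])//; last by case=> [[|[|l]] hl].
  rewrite !mxE /= /row /= /bump /= expr0 !expr1 expr2; ring.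
rewrite detN0 => e; apply/eqP; rewrite -subr_eq0 -oppr_eq0 e; apply/eqP; ring.
Qed.

End RowDeterminants.

(** * Determinants with rows selected by a set of labels: insertion signs *)

Section FlagMinors.
Variables (R : realType) (n : nat).
Implicit Types (I J S : {set 'I_n}) (G : 'M[R]_n).

Definition ord_ltn (i j : 'I_n) : bool := (i < j)%N.

Lemma ord_ltn_trans : transitive ord_ltn.
Proof. by move=> j i k; apply: ltn_trans. Qed.

Lemma sorted_enum_set I : sorted ord_ltn (enum I).
Proof.
rewrite {1}/enum_mem; apply: (sorted_filter ord_ltn_trans).
rewrite -enumT /= -(@sorted_map _ _ val ltn) val_enum_ord.
exact: iota_ltn_sorted.
Qed.

Lemma sorted_filter_enum_set I (q : pred 'I_n) : sorted ord_ltn (seq.filter q (enum I)).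
Proof. exact: (sorted_filter ord_ltn_trans _ (sorted_enum_set I)). Qed.

Lemma mem_filter_enum_set I (q : pred 'I_n) i :
  (i \in seq.filter q (enum I)) = q i && (i \in I).
Proof. by rewrite mem_filter mem_enum. Qed.

Lemma eq_sorted_enum_set I (s : seq 'I_n) :
  sorted ord_ltn s -> s =i I -> enum I = s.
Proof.
move=> ss sI; apply: (irr_sorted_eq ord_ltn_trans) => //.
- by move=> i; rewrite /ord_ltn ltnn.
- exact: sorted_enum_set.
- by move=> i; rewrite mem_enum sI.
Qed.

Lemma enum_setU1 (S : {set 'I_n}) (x : 'I_n) : x \notin S ->
  enum (x |: S)
  = [seq i : 'I_n <- enum S | (i < x)%N] ++ x :: [seq i : 'I_n <- enum S | (x < i)%N].
Proof.
move=> xS; apply: eq_sorted_enum_set.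
  rewrite (sorted_pairwise ord_ltn_trans) pairwise_cat pairwise_cons.
  rewrite -!(sorted_pairwise ord_ltn_trans).
  rewrite !sorted_filter_enum_set ?andbT /=.
  apply/andP; split; last by apply/allP => i; rewrite mem_filter => /andP[].
  apply/allrelP => i j; rewrite mem_filter inE => /andP[ix _].
  case/predU1P => [->//|]; rewrite mem_filter => /andP[xj _].
  exact: ltn_trans ix xj.
move=> i; rewrite mem_cat in_cons !mem_filter_enum_set in_setU1.
rewrite -val_eqE /=; case: (ltngtP i x) => [ix|ix|/val_inj ->] /=;
  by rewrite ?orbF ?orbT.
Qed.

Lemma enum_filter_lt_gt (S : {set 'I_n}) (x : 'I_n) : x \notin S ->
  [seq i : 'I_n <- enum S | (i < x)%N] ++ [seq i : 'I_n <- enum S | (x < i)%N] = enum S.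
Proof.
move=> xS; apply/esym/eq_sorted_enum_set.
  rewrite (sorted_pairwise ord_ltn_trans) pairwise_cat.
  rewrite -!(sorted_pairwise ord_ltn_trans).
  rewrite !sorted_filter_enum_set ?andbT /=.
  apply/allrelP => i j; rewrite !mem_filter_enum_set => /andP[ix _] /andP[xj _].
  exact: ltn_trans ix xj.
move=> i; rewrite mem_cat !mem_filter_enum_set.
case: (ltngtP i x) => //= [ix|/val_inj ->]; rewrite ?orbF//.
by rewrite (negbTE xS).
Qed.

Definition n_below (S : {set 'I_n}) (x : 'I_n) : nat :=
  size [seq i : 'I_n <- enum S | (i < x)%N].

Lemma n_below_setU1 S (x y : 'I_n) : y \notin S -> (x < y)%N ->
  n_below (y |: S) x = n_below S x.
Proof.
move=> yS xy; rewrite /n_below -[in RHS](enum_filter_lt_gt yS) enum_setU1//.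
by rewrite !filter_cat /= ltnNge (ltnW xy).
Qed.

(** The prefix p holds rows already pulled to the front, so that labels can be extracted one after
    the other. *)
Lemma rdet_enum_setU1 (A : 'I_n -> nat -> R) (p : seq (nat -> R)) S x : x \notin S ->
  rdet (p ++ map A (enum (x |: S)))
  = (-1) ^+ n_below S x * rdet (p ++ A x :: map A (enum S)).
Proof.
move=> xS; rewrite enum_setU1// map_cat /= rdet_move -map_cat.
by rewrite enum_filter_lt_gt// size_map.
Qed.

(** Moving the rows of a, b and c to the front costs the same total sign in all three products,
    since each product contains each of the three labels once. The factor [sg] is harmless too:
    every product pairs a set of size |S| + 1 with one of size |S| + 2. *)
Lemma plucker_positive_rdet (A : 'I_n -> nat -> R) (sg : nat -> R) :
  (forall S, 0 < sg #|S| * rdet (map A (enum S))) ->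
  plucker_positive (fun S => sg #|S| * rdet (map A (enum S))).
Proof.
move=> P0; split=> // S a b c ab bc aS bS cS.
have ac := ltn_trans ab bc.
have ne (x y : 'I_n) : (x < y)%N -> x == y = false by move=> xy; rewrite -val_eqE ltn_eqF.
rewrite !(cardsU1, in_setU1) !ne//= aS bS cS.
have E1 x : x \notin S -> rdet (map A (enum (x |: S)))
    = (-1) ^+ n_below S x * rdet (A x :: map A (enum S)).
  by move=> xS; apply: (@rdet_enum_setU1 A [::]).
have E2 (x y : 'I_n) : (x < y)%N -> x \notin S -> y \notin S ->
    rdet (map A (enum (x |: (y |: S)))) = (-1) ^+ n_below S x
      * ((-1) ^+ n_below S y * rdet [:: A x, A y & map A (enum S)]).
  move=> xy xS yS; rewrite (@rdet_enum_setU1 A [::]) ?in_setU1 ?ne//.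
  by rewrite n_below_setU1// (@rdet_enum_setU1 A [:: A x]).
rewrite !E1// !E2//.
have := rdet_plucker (map A (enum S)) (A a) (A b) (A c).
set K := map A (enum S).
move: (rdet (A a :: K)) (rdet (A b :: K)) (rdet (A c :: K)).
move: (rdet [:: A a, A b & K]) (rdet [:: A a, A c & K]) (rdet [:: A b, A c & K]).
move=> rab rac rbc ra rb rc e.
set ea := (-1) ^+ n_below S a; set eb := (-1) ^+ n_below S b.
set ec := (-1) ^+ n_below S c.
transitivity (sg (1 + #|S|)%N * sg (1 + (1 + #|S|))%N * ea * eb * ec * (rb * rac)).
  ring.
by rewrite e; ring.
Qed.

End FlagMinors.

(** * Minors that do not vanish identically on upper triangular matrices *)

Section Minors.
Variables (R : realType) (n : nat).
Implicit Types (I J S : {set 'I_n}) (G : 'M[R]_n).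

(* Zero-based: the i-th smallest element of [I]. *)
Definition elt I (i : nat) : nat := nth 0%N (map val (enum I)) i.

Lemma elt_enum_val I (i : 'I_#|I|) : elt I i = enum_val i.
Proof.
by rewrite /elt (nth_map (enum_val i)) -?cardE// -enum_val_nth.
Qed.

Lemma nth_enum_elt I i x0 : (i < #|I|)%N -> nth x0 (enum I) i = elt I i :> nat.
Proof. by move=> iI; rewrite /elt (nth_map x0) -?cardE. Qed.

Lemma elt_ltn I i : (i < #|I|)%N -> (elt I i < n)%N.
Proof. by move=> iI; rewrite (elt_enum_val (Ordinal iI)). Qed.

Lemma elt_mono I i j : (i < j)%N -> (j < #|I|)%N -> (elt I i < elt I j)%N.
Proof.
move=> ij jI; have iI := ltn_trans ij jI.
have x0 : 'I_n := enum_val (Ordinal iI).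
rewrite -(nth_enum_elt x0 iI) -(nth_enum_elt x0 jI).
apply: (sorted_ltn_nth (@ord_ltn_trans n) x0 (sorted_enum_set I)) => //;
  by rewrite inE -cardE.
Qed.

Lemma leq_elt I i : (i < #|I|)%N -> (i <= elt I i)%N.
Proof.
elim: i => // i IH iI; apply: leq_ltn_trans (IH (ltnW iI)) _.
exact: elt_mono.
Qed.

Lemma leq_card_ord I : (#|I| <= n)%N.
Proof. by rewrite -[X in (_ <= X)%N]card_ord max_card. Qed.

(** The elements grow by at least one at each step and stay below n. This bound compares a row set
    with the last columns, as [leq_elt] compares the first rows with a column set; hence every flag
    minor is positive. *)
Lemma elt_leq I i : (i < #|I|)%N -> (elt I i <= n - #|I| + i)%N.
Proof.
move=> iI; have In := leq_card_ord I.
suff : forall d, (i + d < #|I|)%N -> (elt I i + d <= elt I (i + d))%N.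
  move=> /(_ (#|I| - i.+1)%N); have e : (i + (#|I| - i.+1) < #|I|)%N by lia.
  by move=> /(_ e); have := elt_ltn e; lia.
elim=> [|d IH] h; first by rewrite !addn0.
have := @elt_mono I (i + d) (i + d.+1); rewrite h !addnS ltnSn => /(_ isT isT).
by have := IH ltac:(lia); lia.
Qed.

(* [H = 1 + P] for the partial permutation matrix P of the bijection I -> J;
   the submatrix of [H] is then lower triangular with diagonal entries 1 or 2. *)
Lemma minor_not_identically0 I J : #|I| = #|J| ->
  (forall i, (i < #|I|)%N -> (elt I i <= elt J i)%N) ->
  exists2 H : 'M[R]_n, in_B H & minor I J H != 0.
Proof.
move=> IJ le_IJ.
pose H : 'M[R]_n := \matrix_(r, c) ((r == c)%:R
  + ((r \in I) && (c == nth r (enum J) (index r (enum I))))%:R).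
have Hdiag i : H i i != 0.
  by rewrite mxE eqxx; case: (_ && _); rewrite -natrD pnatr_eq0.
have natD0 (b : bool) : 1 + b%:R != 0 :> R by rewrite -[1]/(1%:R) -natrD pnatr_eq0.
have trigH : is_trig_mx H^T.
  apply/is_trig_mxP => c r cr; rewrite !mxE -val_eqE gtn_eqF//= add0r.
  case: andP => // -[rI /eqP cE]; exfalso; move: cr.
  have h : (index r (enum I) < #|I|)%N by rewrite cardE index_mem mem_enum.
  rewrite cE nth_enum_elt -?IJ//.
  have := le_IJ _ h; rewrite -(nth_enum_elt r h) nth_index ?mem_enum//.
  by rewrite leqNgt => /negbTE ->.
exists H.
  split=> //; rewrite unitmxE -det_tr det_trig// unitfE.
  by apply/prodf_neq0 => i _; rewrite mxE.
have entry (i j : 'I_#|I|) :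
    H (enum_val i) (nth (enum_val i) (enum J) j) = (elt I i == elt J j)%:R + (i == j)%:R.
  rewrite mxE enum_valP /=.
  have -> : index (enum_val i) (enum I) = i.
    by rewrite {1}(enum_val_nth (enum_val i)) index_uniq ?enum_uniq// -cardE.
  rewrite -!val_eqE /= !nth_enum_elt -?IJ// elt_enum_val; congr (_ + _%:R).
  have [ij|ij|/val_inj ->] := ltngtP i j; rewrite ?eqxx//.
  - by rewrite gtn_eqF// elt_mono -?IJ.
  - by rewrite ltn_eqF// elt_mono -?IJ.
rewrite /minor det_trig.
  apply/prodf_neq0 => i _; rewrite mxE entry eqxx addrC; exact: natD0.
(* For i < j one has [elt I i <= elt J i < elt J j], so the contribution of the identity matrix
   vanishes above the diagonal. *)
apply/is_trig_mxP => i j ij; have ne : (i == j) = false by rewrite -val_eqE ltn_eqF.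
rewrite mxE entry ne addr0.
by rewrite ltn_eqF// (leq_ltn_trans (le_IJ _ (ltn_ord i)))// elt_mono// -IJ.
Qed.

Lemma minor_gt0 G I J : in_Bplus G -> #|I| = #|J| ->
  (forall i, (i < #|I|)%N -> (elt I i <= elt J i)%N) -> 0 < minor I J G.
Proof. by move=> [_ +] IJ le_IJ; apply=> //; apply: minor_not_identically0. Qed.

(* Extension by zero to natural indices, which avoids casts between the
   ordinal types indexing submatrices. *)
Definition mxnat G (i j : nat) : R :=
  if (insub i, insub j) is (Some i', Some j') then G i' j' else 0.

Lemma mxnatE G (i j : 'I_n) : mxnat G i j = G i j.
Proof. by rewrite /mxnat !valK. Qed.

Lemma minorE G I J : #|I| = #|J| ->
  minor I J G = ndet #|I| (fun i j => mxnat G (elt I i) (elt J j)).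
Proof.
move=> IJ; congr (\det _); apply/matrixP => i j; rewrite !mxE elt_enum_val.
by rewrite -(nth_enum_elt (enum_val i)) -?IJ// mxnatE.
Qed.

End Minors.

Lemma map_val_enum_eq (n : nat) (I : {set 'I_n}) (s : seq nat) :
  sorted ltn s -> all (fun e => e < n)%N s -> (forall i : 'I_n, (i : nat) \in s = (i \in I)) ->
  map val (enum I) = s.
Proof.
move=> ss sn sI; apply: (irr_sorted_eq ltn_trans ltnn) => //.
  by rewrite sorted_map; apply: sorted_enum_set.
move=> e; have [en|ne] := ltnP e n; last first.
  transitivity false; last by apply/esym/negbTE/negP => /(allP sn); lia.
  by apply/negbTE/negP => /mapP[i _ ei]; move: ne; rewrite ei leqNgt ltn_ord.
by rewrite -[e]/(val (Ordinal en)) mem_map ?mem_enum ?sI//; apply: val_inj.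
Qed.

Lemma card_map_val_enum (n : nat) (I : {set 'I_n}) (s : seq nat) :
  map val (enum I) = s -> #|I| = size s.
Proof. by move=> <-; rewrite size_map -cardE. Qed.

Lemma map_val_enum_itv (n a b : nat) : (b <= n)%N ->
  map val (enum (itv_set n a.+1 b)) = iota a (b - a).
Proof.
move=> bn; apply: map_val_enum_eq; first exact: iota_ltn_sorted.
  by apply/allP => e; rewrite mem_iota; lia.
by move=> i; rewrite mem_iota inE; lia.
Qed.

Lemma map_val_enum_last (n k : nat) : (k <= n)%N ->
  map val (enum (last_set n k)) = iota (n - k) k.
Proof. by move=> kn; rewrite map_val_enum_itv// subKn. Qed.

Lemma map_val_enum_first (n k : nat) : (k <= n)%N ->
  map val (enum (first_set n k)) = iota 0 k.
Proof. by move=> kn; rewrite map_val_enum_itv// subn0. Qed.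

(** * Positivity and Plücker relations of the two families of flag minors *)

Section FlagMinorsPositive.
Variables (R : realType) (n : nat).
Implicit Types (I J S : {set 'I_n}) (G : 'M[R]_n).

Lemma card_last_set S : #|last_set n #|S| | = #|S|.
Proof. by rewrite (card_map_val_enum (map_val_enum_last (leq_card_ord S))) size_iota. Qed.

Lemma card_first_set S : #|first_set n #|S| | = #|S|.
Proof. by rewrite (card_map_val_enum (map_val_enum_first (leq_card_ord S))) size_iota. Qed.

Lemma elt_last_set S i : (i < #|S|)%N -> elt (last_set n #|S|) i = (n - #|S| + i)%N.
Proof. by move=> iS; rewrite /elt map_val_enum_last ?leq_card_ord// nth_iota. Qed.

Lemma elt_first_set S i : (i < #|S|)%N -> elt (first_set n #|S|) i = i.
Proof. by move=> iS; rewrite /elt map_val_enum_first ?leq_card_ord// nth_iota. Qed.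

Lemma Delta_lo_gt0 G S : in_Bplus G -> 0 < Delta_lo S G.
Proof.
move=> Gp; apply: minor_gt0 => //; first by rewrite card_last_set.
by move=> i iS; rewrite elt_last_set// elt_leq.
Qed.

Lemma Delta_up_gt0 G S : in_Bplus G -> 0 < Delta_up S G.
Proof.
move=> Gp; apply: minor_gt0 => //; first by rewrite card_first_set.
by rewrite card_first_set => i iS; rewrite elt_first_set// leq_elt.
Qed.

Lemma rdet_map_enum (A : nat -> nat -> R) S :
  rdet [seq A i | i : 'I_n <- enum S] = ndet #|S| (fun i j => A (elt S i) j).
Proof.
rewrite /rdet size_map -cardE; apply: eq_ndet => i j iS jS.
have x0 : 'I_n := enum_val (Ordinal iS).
by rewrite (nth_map x0) -?cardE// nth_enum_elt.
Qed.

(** The first of the last |S| columns depends on |S|. Reading columns from the right removes this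
    dependence from the rows, at the cost of this sign, which depends on |S| only. *)
Definition reversal_sign (k : nat) : R := \det (perm_mx (perm (@rev_ord_inj k))^-1%g).

Lemma ndet_reverse_cols k (B : nat -> nat -> R) :
  ndet k (fun i j => B i (k - j.+1)%N) = reversal_sign k * ndet k B.
Proof.
rewrite /ndet /reversal_sign mulrC -det_mulmx -col_permE; congr (\det _).
by apply/matrixP => i j; rewrite !mxE permE.
Qed.

Lemma Delta_loE G S : Delta_lo S G =
  reversal_sign #|S| * rdet [seq (fun j => mxnat G i (n - j.+1)) | i : 'I_n <- enum S].
Proof.
rewrite (rdet_map_enum (fun i j => mxnat G i (n - j.+1))) -ndet_reverse_cols.
rewrite /Delta_lo minorE ?card_last_set//; apply: eq_ndet => i j iS jS.
by rewrite elt_last_set//; congr (mxnat _ _ _); have := leq_card_ord S; lia.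
Qed.

(** After transposition the labels index rows. The factor 1 is the trivial sign that fits the shape
    of [plucker_positive_rdet]. *)
Lemma Delta_upE G S : Delta_up S G =
  1 * rdet [seq (fun j => mxnat G j i) | i : 'I_n <- enum S].
Proof.
rewrite mul1r (rdet_map_enum (fun i j => mxnat G j i)).
rewrite /Delta_up minorE ?card_first_set// /ndet -det_tr; congr (\det _).
by apply/matrixP => i j; rewrite !mxE elt_first_set.
Qed.

Lemma plucker_positive_lo G : in_Bplus G -> plucker_positive (fun S => Delta_lo S G).
Proof.
move=> Gp; have -> : (fun S => Delta_lo S G) = (fun S => reversal_sign #|S|
    * rdet [seq (fun j => mxnat G i (n - j.+1)) | i : 'I_n <- enum S]).
  by apply/funext => S; rewrite Delta_loE.
by apply: plucker_positive_rdet => S; rewrite -Delta_loE Delta_lo_gt0.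
Qed.

Lemma plucker_positive_up G : in_Bplus G -> plucker_positive (fun S => Delta_up S G).
Proof.
move=> Gp; have -> : (fun S => Delta_up S G) = (fun S => 1
    * rdet [seq (fun j => mxnat G j i) | i : 'I_n <- enum S]).
  by apply/funext => S; rewrite Delta_upE.
by apply: (@plucker_positive_rdet R n _ (fun=> 1)) => S; rewrite -Delta_upE Delta_up_gt0.
Qed.

End FlagMinorsPositive.

(** * From the Rogers dilogarithm to the sums of l *)

Section LdilogSums.
Variable R : realType.

(** The substitution u = x/(1 + x) turns x -> 1/x into u -> 1 - u. *)
Lemma ldilog_inv : exists C : R, forall x, 0 < x -> ldilog x + ldilog (1 / x) = C.
Proof.
have [C refl] := rogers_reflection R; exists (6 / pi ^+ 2 * C) => x x0.
have x10 : 0 < 1 + x by rewrite addr_gt0.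
rewrite /ldilog -mulrDr; congr (_ * _).
have -> : 1 / x / (1 + 1 / x) = 1 - x / (1 + x).
  by field; rewrite !lt0r_neq0// addrC.
by apply: refl; rewrite divr_gt0//= ltr_pdivrMr// mul1r ltrDr.
Qed.

Variable n : nat.
Implicit Types (P : {set 'I_n} -> R) (K : pred nat) (G H : 'M[R]_n).

(** The common form of the lower Y-variables and of the inverses of the upper ones; only K varies
    with the type. *)
Definition flip_Y P K (a b c : nat) : R :=
  P (label_set n [pred e | (e == a) || K e])
  * P (label_set n [pred e | [|| e == b, e == c | K e]])
  / (P (label_set n [pred e | [|| e == a, e == b | K e]])
     * P (label_set n [pred e | (e == c) || K e])).

Lemma flip_Y_gt0 P K a b c : plucker_positive P -> 0 < flip_Y P K a b c.
Proof. by move=> [P0 _]; rewrite /flip_Y divr_gt0// mulr_gt0. Qed.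

(** For x = 1/Y, the three-term relation collapses the denominator of x/(1 + x) to P(Kb) P(Kac),
    which leaves u(abc;K). *)
Lemma ldilog_flip_Y P K a b c : plucker_positive P ->
  (0 < a)%N -> (a < b)%N -> (b < c)%N -> (c <= n)%N -> ~~ K a -> ~~ K b -> ~~ K c ->
  ldilog (1 / flip_Y P K a b c) = 6 / pi ^+ 2 * rogers_dilog (label_ratio P K a b c).
Proof.
move=> [P0 Pl]; case: a => // a _; case: b => // b ab; case: c => // c bc cn Ka Kb Kc.
have [an bn] : (a < n)%N /\ (b < n)%N by split; lia.
have := Pl (label_set n K) (Ordinal an) (Ordinal bn) (Ordinal cn) ab bc.
rewrite !inE => /(_ Ka Kb Kc).
have lset (x : 'I_n) (K' : pred nat) :
    x |: label_set n K' = label_set n [pred e | (e == x.+1) || K' e].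
  by apply/setP => i; rewrite !inE eqSS -val_eqE.
rewrite !lset /= => e; rewrite /ldilog; congr (_ * rogers_dilog _).
rewrite /label_ratio /flip_Y e.
move: (P0 (label_set n [pred e | [|| e == a.+1, e == b.+1 | K e]])).
move: (P0 (label_set n [pred e | [|| e == b.+1, e == c.+1 | K e]])).
move: (P0 (label_set n [pred e | (e == a.+1) || K e])).
move: (P0 (label_set n [pred e | (e == c.+1) || K e])).
move: (P _) (P _) (P _) (P _) => pc pa pbc pab pc0 pa0 pbc0 pab0.
by field; rewrite !lt0r_neq0 ?addr_gt0 ?mulr_gt0.
Qed.

Lemma sum_ldilog_flip_Y P : plucker_positive P ->
  sum_T n (fun a b c => ldilog (1 / flip_Y P (three_blocks 0 a.+1 b.-1 c.+1) a b c))
  = sum_T n (fun a b c => ldilog (1 / flip_Y P (three_blocks a.-1 b.+1 c.-1 n.+1) a b c)).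
Proof.
move=> Pp; pose k : R := 6 / pi ^+ 2.
have sumZ (F : nat -> nat -> nat -> R) :
    sum_T n (fun a b c => k * F a b c) = k * sum_T n F.
  rewrite /sum_T mulr_sumr; apply: eq_bigr => a _; rewrite mulr_sumr.
  by apply: eq_bigr => b _; rewrite mulr_sumr.
have := congr1 (fun x => k * x) (sum_label_ratio Pp); rewrite -!sumZ => e.
transitivity (sum_T n (fun a b c => k *
    rogers_dilog (label_ratio P (three_blocks 0 a.+1 b.-1 c.+1) a b c))).
  by apply: eq_sum_T => a b c *; rewrite ldilog_flip_Y//; rewrite /three_blocks; lia.
rewrite e; apply: eq_sum_T => a b c *.
by rewrite ldilog_flip_Y//; rewrite /three_blocks; lia.
Qed.

Lemma Y_loE G a b c : (0 < a)%N -> (a < b)%N -> (b < c)%N -> (c <= n)%N ->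
  Y_lo G a b c = flip_Y (fun S => Delta_lo S G) (three_blocks 0 a.+1 b.-1 c.+1) a b c.
Proof.
move=> a0 ab bc cn; rewrite /Y_lo /flip_Y.
by congr (_ * _ / (_ * _)); congr (Delta_lo _ G);
  apply/setP => i; rewrite !inE /three_blocks /=; have := ltn_ord i; lia.
Qed.

Lemma Yt_loE G a b c : (0 < a)%N -> (a < b)%N -> (b < c)%N -> (c <= n)%N ->
  Yt_lo G a b c = flip_Y (fun S => Delta_lo S G) (three_blocks a.-1 b.+1 c.-1 n.+1) a b c.
Proof.
move=> a0 ab bc cn; rewrite /Yt_lo /flip_Y.
by congr (_ * _ / (_ * _)); congr (Delta_lo _ G);
  apply/setP => i; rewrite !inE /three_blocks /=; have := ltn_ord i; lia.
Qed.

Lemma Y_upE G a b c : (0 < a)%N -> (a < b)%N -> (b < c)%N -> (c <= n)%N ->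
  Y_up G a b c = (flip_Y (fun S => Delta_up S G) (three_blocks 0 a.+1 b.-1 c.+1) a b c)^-1.
Proof.
move=> a0 ab bc cn; rewrite /Y_up /flip_Y invf_div.
by congr (_ * _ / (_ * _)); congr (Delta_up _ G);
  apply/setP => i; rewrite !inE /three_blocks /=; have := ltn_ord i; lia.
Qed.

Lemma Yt_upE G a b c : (0 < a)%N -> (a < b)%N -> (b < c)%N -> (c <= n)%N ->
  Yt_up G a b c = (flip_Y (fun S => Delta_up S G) (three_blocks a.-1 b.+1 c.-1 n.+1) a b c)^-1.
Proof.
move=> a0 ab bc cn; rewrite /Yt_up /flip_Y invf_div.
by congr (_ * _ / (_ * _)); congr (Delta_up _ G);
  apply/setP => i; rewrite !inE /three_blocks /=; have := ltn_ord i; lia.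
Qed.

(** Both sums run over the same triples, so the constants l(x) + l(1/x) add up to the same total on
    each side. *)
Lemma sum_ldilog_inv (F F' : nat -> nat -> nat -> R) :
  (forall a b c, (0 < a)%N -> (a < b)%N -> (b < c)%N -> (c <= n)%N -> 0 < F a b c) ->
  (forall a b c, (0 < a)%N -> (a < b)%N -> (b < c)%N -> (c <= n)%N -> 0 < F' a b c) ->
  sum_T n (fun a b c => ldilog (1 / F a b c)) = sum_T n (fun a b c => ldilog (1 / F' a b c)) ->
  sum_T n (fun a b c => ldilog (F a b c)) = sum_T n (fun a b c => ldilog (F' a b c)).
Proof.
move=> F0 F'0 e; apply/(addIr (sum_T n (fun a b c => ldilog (1 / F a b c)))).
rewrite [in RHS]e -!sum_TD; have [C CE] := ldilog_inv.
by apply: eq_sum_T => a b c *; rewrite !CE ?F0 ?F'0.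
Qed.

Lemma sum_ldilog_lo G : in_Bplus G ->
  sum_T n (fun a b c => ldilog (1 / Y_lo G a b c))
  = sum_T n (fun a b c => ldilog (1 / Yt_lo G a b c)).
Proof.
move=> /plucker_positive_lo/sum_ldilog_flip_Y e.
under eq_sum_T => a b c a0 ab bc cn do rewrite Y_loE//.
rewrite e; apply: eq_sum_T => a b c *; by rewrite Yt_loE.
Qed.

(** The upper variables are inverses of [flip_Y], so the telescoped identity is first passed through
    the inversion x -> 1/x. *)
Lemma sum_ldilog_up G : in_Bplus G ->
  sum_T n (fun a b c => ldilog (1 / Y_up G a b c))
  = sum_T n (fun a b c => ldilog (1 / Yt_up G a b c)).
Proof.
move=> /plucker_positive_up Pp; have e := sum_ldilog_flip_Y Pp.
have {}e := sum_ldilog_inv (fun a b c _ _ _ _ => flip_Y_gt0 _ a b c Pp)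
  (fun a b c _ _ _ _ => flip_Y_gt0 _ a b c Pp) e.
transitivity (sum_T n (fun a b c => ldilog
    (flip_Y (fun S => Delta_up S G) (three_blocks 0 a.+1 b.-1 c.+1) a b c))).
  by apply: eq_sum_T => a b c *; rewrite Y_upE// div1r invrK.
by rewrite e; apply: eq_sum_T => a b c *; rewrite Yt_upE// div1r invrK.
Qed.

End LdilogSums.

(** * Solid minors and the maps check and hat *)

Lemma ndet_ublock (R : fieldType) (k m : nat) (A : nat -> nat -> R) :
  (forall i j, (k <= i)%N -> (i < k + m)%N -> (j < k)%N -> A i j = 0) ->
  ndet (k + m) A = ndet k A * ndet m (fun i j => A (k + i)%N (k + j)%N).
Proof.
move=> A0; rewrite /ndet -[X in \det X]submxK.
set M := \matrix_(i < k + m, j < k + m) A i j.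
have -> : dlsubmx M = 0 by apply/matrixP => i j; rewrite !mxE A0//= ?leq_addr// ltn_add2l.
by rewrite det_ublock; congr (_ * _); congr (\det _); apply/matrixP => i j; rewrite !mxE.
Qed.

Section SolidMinors.
Variables (R : realType) (n : nat).
Implicit Types (G H : 'M[R]_n).

(* Rows r, ..., r + k - 1 and columns s, ..., s + k - 1, zero-based. *)
Definition solid_minor G (r s k : nat) : R :=
  ndet k (fun i j => mxnat G (r + i) (s + j)).

Lemma mxnat_in_B G i j : in_B G -> (j < i)%N -> mxnat G i j = 0.
Proof.
move=> [/is_trig_mxP trG _] ji; rewrite /mxnat.
case: insubP => // i' _ ei; case: insubP => // j' _ ej.
by have := trG j' i'; rewrite ei ej mxE; apply.
Qed.

Lemma map_val_enum_itv2 (a b c d : nat) : (0 < a)%N -> (b < c)%N -> (d <= n)%N ->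
  (b <= n)%N ->
  map val (enum (itv_set n a b :|: itv_set n c d))
  = iota a.-1 (b - a.-1) ++ iota c.-1 (d - c.-1).
Proof.
move=> a0 bc dn bn; apply: map_val_enum_eq.
- rewrite (sorted_pairwise ltn_trans) pairwise_cat -!(sorted_pairwise ltn_trans).
  rewrite !iota_ltn_sorted !andbT; apply/allrelP => x y; rewrite !mem_iota; lia.
- by apply/allP => x; rewrite mem_cat !mem_iota; lia.
- by move=> i; rewrite mem_cat !mem_iota !inE; lia.
Qed.

(** The rows with labels in [c,n] vanish on columns before c, so the submatrix is block triangular;
    its second block gives a trailing principal minor. Either interval may be empty. *)
Lemma Delta_lo_solid G (a b c : nat) : in_B G -> (0 < a)%N -> (a <= b.+1)%N ->
  (b < c)%N -> (c <= n.+1)%N ->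
  Delta_lo (itv_set n a b :|: itv_set n c n) G =
  solid_minor G a.-1 (c.-1 - (b.+1 - a)) (b.+1 - a)
  * solid_minor G c.-1 c.-1 (n.+1 - c).
Proof.
move=> GB a0 ab bc cn; set I := _ :|: _.
have bn : (b <= n)%N by lia.
have eI := map_val_enum_itv2 a0 bc (leqnn n) bn.
have cI : #|I| = (b.+1 - a + (n.+1 - c))%N.
  by rewrite (card_map_val_enum eI) size_cat !size_iota; lia.
rewrite /Delta_lo minorE ?card_last_set//.
rewrite (_ : ndet _ _ = ndet (b.+1 - a + (n.+1 - c)) (fun i j =>
  mxnat G (if (i < b.+1 - a)%N then a.-1 + i else c.-1 + (i - (b.+1 - a)))%N
          (c.-1 - (b.+1 - a) + j))); last first.
  rewrite -cI; apply: eq_ndet => i j iI jI; rewrite elt_last_set//.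
  congr (mxnat _ _ _); last by rewrite cI; lia.
  rewrite /elt eI nth_cat size_iota (_ : (b - a.-1 = b.+1 - a)%N); last by lia.
  by case: ifP => h; rewrite nth_iota//; move: iI; rewrite cI; lia.
rewrite ndet_ublock; last first.
  by move=> i j ki im jk; apply: mxnat_in_B => //; case: ifP; lia.
congr (_ * _); apply: eq_ndet => i j hi hj; first by rewrite hi.
rewrite ifF; last by lia.
by congr (mxnat _ _ _); lia.
Qed.

(** Again block triangular: the columns [1,a] vanish below row a, and the first block is a leading
    principal minor. *)
Lemma Delta_up_solid G (a b c : nat) : in_B G -> (a < b)%N -> (b <= c.+1)%N ->
  (c <= n)%N ->
  Delta_up (itv_set n 1 a :|: itv_set n b c) G =
  solid_minor G 0 0 a * solid_minor G a b.-1 (c.+1 - b).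
Proof.
move=> GB ab bc cn; set J := _ :|: _.
have an : (a <= n)%N by lia.
have eJ := map_val_enum_itv2 (ltnSn 0) ab cn an.
have cJ : #|J| = (a + (c.+1 - b))%N.
  by rewrite (card_map_val_enum eJ) size_cat !size_iota; lia.
rewrite /Delta_up minorE ?card_first_set//.
rewrite (_ : ndet _ _ = ndet (a + (c.+1 - b)) (fun i j =>
  mxnat G i (if (j < a)%N then j else b.-1 + (j - a))%N)); last first.
  rewrite -cJ; apply: eq_ndet => i j iJ jJ; rewrite elt_first_set//.
  congr (mxnat _ _ _); rewrite /elt eJ nth_cat size_iota subn0.
  by case: ifP => h; rewrite nth_iota//; move: jJ; rewrite cJ; lia.
rewrite ndet_ublock; last first.
  by move=> i j ai ic ja; apply: mxnat_in_B => //; rewrite ja; lia.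
congr (_ * _); apply: eq_ndet => i j hi hj; first by rewrite hj.
rewrite ifF; last by lia.
by congr (mxnat _ _ _); lia.
Qed.

(** The leading principal minors cancel on the left and the trailing ones on the right; the same
    four solid minors remain. *)
Lemma Yt_up_Y_lo G a b c : in_Bplus G ->
  (0 < a)%N -> (a < b)%N -> (b < c)%N -> (c <= n)%N ->
  Yt_up G a b c = Y_lo G a (a + c - b) c.
Proof.
move=> Gp a0 ab bc cn; have GB := Gp.1.
(* Principal minors at either corner are flag minors in which one of the two intervals is empty,
   hence nonzero. *)
have lead0 k : (k <= n)%N -> solid_minor G 0 0 k != 0.
  move=> kn; have := Delta_up_gt0 (itv_set n 1 k :|: itv_set n k.+1 k) Gp.
  rewrite Delta_up_solid//; apply: contraTneq => ->.
  by rewrite mul0r ltxx.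
have trail0 k : (0 < k <= n.+1)%N -> solid_minor G k.-1 k.-1 (n.+1 - k) != 0.
  move=> kn; have := Delta_lo_gt0 (itv_set n 1 0 :|: itv_set n k n) Gp.
  rewrite Delta_lo_solid//; try lia.
  by apply: contraTneq => ->; rewrite mulr0 ltxx.
have cancel2 (x y p q r t : R) : x != 0 -> y != 0 ->
    x * p * (y * q) / (x * r * (y * t)) = p * q / (r * t).
  by move=> x0 y0; rewrite mulrACA [x * r * _]mulrACA -mulf_div divff ?mulf_neq0 ?mul1r.
have -> : Yt_up G a b c =
    solid_minor G a b.-1 (c - b) * solid_minor G a.-1 b (c - b)
    / (solid_minor G a b (c - b.+1) * solid_minor G a.-1 b.-1 (c.+1 - b)).
  rewrite /Yt_up !Delta_up_solid//; try lia.
  rewrite cancel2 ?lead0//; try lia.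
  by congr (_ * _ / (_ * _)); congr (solid_minor G); lia.
rewrite /Y_lo !Delta_lo_solid//; try lia.
rewrite !(mulrC _ (solid_minor G (c + 1).-1 _ _)) !(mulrC _ (solid_minor G c.-1 c.-1 _)).
rewrite cancel2 ?trail0//; try lia.
rewrite [X in _ = X / _]mulrC [X in _ = _ / X]mulrC.
by congr (_ * _ / (_ * _)); congr (solid_minor G); lia.
Qed.

Lemma sum_T_mid (F : nat -> nat -> nat -> R) :
  sum_T n (fun a b c => F a (a + c - b)%N c) = sum_T n F.
Proof.
rewrite !sum_TE; apply: eq_big_nat => a ha.
rewrite exchange_big [RHS]exchange_big /=; apply: eq_big_nat => c hc.
have mid (f : nat -> R) : \sum_(1 <= b < n.+1) (if (a < b < c)%N then f b else 0)
    = \sum_(a.+1 <= b < c) f b.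
  rewrite (@big_nat_widenl _ _ _ a.+1 1)//= (@big_nat_widen _ _ _ _ c n.+1); last by lia.
  by rewrite [RHS]big_mkcond.
by rewrite !mid big_nat_rev; apply: eq_big_nat => b hb; congr F; lia.
Qed.

Lemma sum_T_rev (F : nat -> nat -> nat -> R) :
  sum_T n (fun a b c => F (n.+1 - c)%N (n.+1 - b)%N (n.+1 - a)%N) = sum_T n F.
Proof.
rewrite !sum_TE big_nat_rev.
transitivity (\sum_(1 <= a < n.+1) \sum_(1 <= b < n.+1) \sum_(1 <= c < n.+1)
    if (c < b < a)%N then F c b a else 0).
  apply: eq_big_nat => a ha; rewrite big_nat_rev; apply: eq_big_nat => b hb.
  rewrite big_nat_rev; apply: eq_big_nat => c hc.
  have -> : ((1 + n.+1 - a.+1 < 1 + n.+1 - b.+1) && (1 + n.+1 - b.+1 < 1 + n.+1 - c.+1)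
    = (c < b < a))%N by lia.
  by case: ifP => // _; congr F; lia.
under eq_bigr => a _ do rewrite exchange_big.
rewrite exchange_big /=; apply: eq_bigr => c _.
by rewrite exchange_big.
Qed.

(** Reversing labels carries [a+1,b-1] u [c+1,n] to the set [1,a'-1] u [b'+1,c'-1] of the reversed
    triple (a',b',c'). It exchanges the roles of a and c, which swaps numerator and denominator. *)
Lemma Y_lo_check G H a b c : is_check G H ->
  (0 < a)%N -> (a < b)%N -> (b < c)%N -> (c <= n)%N ->
  Y_lo H a b c = 1 / Yt_lo G (n.+1 - c) (n.+1 - b) (n.+1 - a).
Proof.
move=> [_ HG] a0 ab bc cn; rewrite /Y_lo /Yt_lo div1r invf_div !HG.
rewrite [X in _ = X / _]mulrC [X in _ = _ / X]mulrC.
by congr (_ * _ / (_ * _)); congr (Delta_lo _ G); apply/setP => i;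
  rewrite !inE /=; have := ltn_ord i; lia.
Qed.

Lemma Y_up_hat G H a b c : is_hat G H ->
  (0 < a)%N -> (a < b)%N -> (b < c)%N -> (c <= n)%N ->
  Y_up H a b c = 1 / Yt_up G (n.+1 - c) (n.+1 - b) (n.+1 - a).
Proof.
move=> [_ HG] a0 ab bc cn; rewrite /Y_up /Yt_up div1r invf_div !HG.
rewrite [X in _ = X / _]mulrC [X in _ = _ / X]mulrC.
by congr (_ * _ / (_ * _)); congr (Delta_up _ G); apply/setP => i;
  rewrite !inE /=; have := ltn_ord i; lia.
Qed.

Lemma sum_ldilog_up_lo G : in_Bplus G ->
  sum_T n (fun a b c => ldilog (1 / Yt_up G a b c))
  = sum_T n (fun a b c => ldilog (1 / Y_lo G a b c)).
Proof.
move=> Gp; rewrite -[RHS]sum_T_mid.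
by apply: eq_sum_T => a b c *; rewrite Yt_up_Y_lo.
Qed.

End SolidMinors.

(** * Linking the sums for G and its two images *)

Section AllSums.
Variables (R : realType) (n : nat).
Implicit Types (G H : 'M[R]_n).

Lemma sums_inv_eq G : in_Bplus G ->
  [/\ sum_T n (fun a b c => ldilog (1 / Yt_lo G a b c))
      = sum_T n (fun a b c => ldilog (1 / Y_lo G a b c)),
      sum_T n (fun a b c => ldilog (1 / Yt_up G a b c))
      = sum_T n (fun a b c => ldilog (1 / Y_lo G a b c)) &
      sum_T n (fun a b c => ldilog (1 / Y_up G a b c))
      = sum_T n (fun a b c => ldilog (1 / Y_lo G a b c))].
Proof.
by move=> Gp; rewrite sum_ldilog_up// -sum_ldilog_lo// sum_ldilog_up_lo.
Qed.

Lemma sums_eq G : in_Bplus G ->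
  [/\ sum_T n (fun a b c => ldilog (Yt_lo G a b c))
      = sum_T n (fun a b c => ldilog (Y_lo G a b c)),
      sum_T n (fun a b c => ldilog (Yt_up G a b c))
      = sum_T n (fun a b c => ldilog (Y_lo G a b c)) &
      sum_T n (fun a b c => ldilog (Y_up G a b c))
      = sum_T n (fun a b c => ldilog (Y_lo G a b c))].
Proof.
move=> Gp; have [e1 e2 e3] := sums_inv_eq Gp.
have lo := plucker_positive_lo Gp; have up := plucker_positive_up Gp.
by split; apply: sum_ldilog_inv => // a b c *;
  rewrite ?Y_loE ?Yt_loE ?Y_upE ?Yt_upE ?invr_gt0 ?flip_Y_gt0.
Qed.

Lemma sum_check G H : in_Bplus G -> is_check G H ->
  sum_T n (fun a b c => ldilog (Y_lo H a b c))
  = sum_T n (fun a b c => ldilog (1 / Y_lo G a b c)).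
Proof.
move=> Gp GH; have [<- _ _] := sums_inv_eq Gp; rewrite -[RHS]sum_T_rev.
by apply: eq_sum_T => a b c *; rewrite (Y_lo_check GH).
Qed.

Lemma sum_hat G H : in_Bplus G -> is_hat G H ->
  sum_T n (fun a b c => ldilog (Y_up H a b c))
  = sum_T n (fun a b c => ldilog (1 / Y_lo G a b c)).
Proof.
move=> Gp GH; have [_ <- _] := sums_inv_eq Gp; rewrite -[RHS]sum_T_rev.
by apply: eq_sum_T => a b c *; rewrite (Y_up_hat GH).
Qed.

End AllSums.

Theorem theorem3 (R : realType) (n : nat) (hn : (3 <= n)%N)
    (G Gcheck Ghat : 'M[R]_n) (hG : in_Bplus G)
    (hcheck : is_check G Gcheck) (hhat : is_hat G Ghat) :
  constant [::
    sum_T n (fun a b c => ldilog (Y_lo Gcheck a b c));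
    sum_T n (fun a b c => ldilog (1 / Y_lo G a b c));
    sum_T n (fun a b c => ldilog (Y_lo Ghat a b c));
    sum_T n (fun a b c => ldilog (Yt_up Gcheck a b c));
    sum_T n (fun a b c => ldilog (1 / Yt_up G a b c));
    sum_T n (fun a b c => ldilog (Yt_up Ghat a b c));
    sum_T n (fun a b c => ldilog (Yt_lo Gcheck a b c));
    sum_T n (fun a b c => ldilog (1 / Yt_lo G a b c));
    sum_T n (fun a b c => ldilog (Yt_lo Ghat a b c));
    sum_T n (fun a b c => ldilog (Y_up Gcheck a b c));
    sum_T n (fun a b c => ldilog (1 / Y_up G a b c));
    sum_T n (fun a b c => ldilog (Y_up Ghat a b c))].
Proof.
(* The check and hat images are themselves totally positive, so the four sums of each agree, as do
   the four inverse sums of G. One link from each image to G, [ck] and [hh], joins the three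
   groups. *)
have [g1 g2 g3] := sums_inv_eq hG; have [c1 c2 c3] := sums_eq hcheck.1.
have [h1 h2 h3] := sums_eq hhat.1.
have ck := sum_check hG hcheck; have hh := sum_hat hG hhat; rewrite h3 in hh.
by rewrite /= c1 c2 c3 h1 h2 h3 g1 g2 g3 ck hh !eqxx.
Qed.
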